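(* Let $\Gamma$ be a finite undirected graph and $A_\Gamma$ its right angled Artin group. Let $\gamma_n$, $\gamma_{n,0}$ and, for a prime $p$, $\gamma_{n,p}$ denote respectively the lower central series, the rational lower central series and the $p$-central series of $A_\Gamma$ ($n\ge1$). Then $$\gamma_n=\gamma_{n,0}\ \text{ for all } n\ge 1,\qquad\text{and}\qquad \bigcap_{n\ge1}\gamma_{n,0}=\bigcap_{n\ge1}\gamma_{n,p}=\{1\}.$$ In particular, $A_\Gamma$ is finitely generated and residually torsion-free nilpotent, and so $A_\Gamma$ is also a residually finite $p$-group (i.e. residually a finite $p$-group) for every prime $p$.
   Context: $\Gamma$ has vertex set $V$ and edge set $E$, consisting of $2$-element subsets of $V$, and $A_\Gamma=\langle V\mid vw=wv\text{ whenever }\{v,w\}\in E\rangle$. For a group $G$: $\gamma_1=G$ and $\gamma_n=[\gamma_{n-1},G]$; $\gamma_{n,0}=\{g\in G\mid g^k\in\gamma_n\text{ for some integer }k\neq0\}$; for a prime $p$, $\gamma_{1,p}=G$ and $\gamma_{n,p}=[\gamma_{n-1,p},G]\,\gamma_{\lceil n/p\rceil,p}^p$, equivalently $\gamma_{n,p}=\prod_{mp^i\ge n}\gamma_m^{p^i}$, where $H^{q}$ denotes the subgroup generated by the $q$-th powers of elements of $H$. A group is residually of some type if every non-trivial element has non-trivial image in some quotient of that type. *)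

(* Defs.v *)
From HB Require Import structures.
From mathcomp Require Import all_boot all_order all_algebra.
From mathcomp Require Import zify.
From mathcomp Require Import boolp classical_sets functions cardinality.

Set Implicit Arguments.
Unset Strict Implicit.
Unset Printing Implicit Defensive.

Local Open Scope group_scope.
Local Open Scope quotient_scope.
Local Open Scope classical_set_scope.

(* The group < X | u = v whenever R u v >. A word is a sequence of letters;
   (x, true) stands for x and (x, false) for its inverse. *)
Section Presentation.
Variables (X : choiceType) (R : seq (X * bool) -> seq (X * bool) -> Prop).

Definition inv_letter (a : X * bool) : X * bool := (a.1, ~~ a.2).

Definition inv_word (w : seq (X * bool)) := rev (map inv_letter w).

Inductive word_eq : seq (X * bool) -> seq (X * bool) -> Prop :=
| word_eq_rel u v : R u v -> word_eq u v
| word_eq_cancel a : word_eq [:: a; inv_letter a] [::]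
| word_eq_cat u u' v v' :
    word_eq u u' -> word_eq v v' -> word_eq (u ++ v) (u' ++ v')
| word_eq_refl u : word_eq u u
| word_eq_sym u v : word_eq u v -> word_eq v u
| word_eq_trans v u w : word_eq u v -> word_eq v w -> word_eq u w.

Definition word_eqb : rel (seq (X * bool)) := fun u v => `[< word_eq u v >].

Lemma word_eqb_refl : reflexive word_eqb.
Proof. by move=> u; apply/asboolP; exact: word_eq_refl. Qed.

Lemma word_eqb_sym : symmetric word_eqb.
Proof. by move=> u v; apply/asboolP/asboolP; exact: word_eq_sym. Qed.

Lemma word_eqb_trans : transitive word_eqb.
Proof.
move=> v u w /asboolP uv /asboolP vw; apply/asboolP.
exact: word_eq_trans uv vw.
Qed.

Canonical word_eqb_equiv :=
  EquivRel word_eqb word_eqb_refl word_eqb_sym word_eqb_trans.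

Definition presented_group : Type := {eq_quot word_eqb_equiv}.

HB.instance Definition _ := Choice.on presented_group.
HB.instance Definition _ := Quotient.on presented_group.

Definition word_class (w : seq (X * bool)) : presented_group :=
  \pi_presented_group w.

Lemma word_classP u v : word_class u = word_class v <-> word_eq u v.
Proof.
split=> [/eqmodP/asboolP //|uv].
by apply/eqmodP; apply/asboolP.
Qed.

Lemma repr_word_class u : word_eq (repr (word_class u)) u.
Proof. by apply/word_classP; rewrite /word_class reprK. Qed.

Lemma word_classK (x : presented_group) : word_class (repr x) = x.
Proof. exact: reprK. Qed.

Lemma inv_letterK : involutive inv_letter.
Proof. by case=> x b; rewrite /inv_letter /= negbK. Qed.

Lemma word_eq_mulV w : word_eq (w ++ inv_word w) [::].
Proof.
elim: w => [|a w IHw]; first exact: word_eq_refl.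
rewrite /inv_word map_cons rev_cons -cats1 cat_cons catA.
apply: word_eq_trans (word_eq_cancel a).
have /= := word_eq_cat (word_eq_refl [:: a])
  (word_eq_cat IHw (word_eq_refl [:: inv_letter a])).
by [].
Qed.

Lemma inv_wordK : involutive inv_word.
Proof. by move=> w; rewrite /inv_word map_rev revK mapK //; apply: inv_letterK. Qed.

Lemma word_eq_mulVl w : word_eq (inv_word w ++ w) [::].
Proof. by have := word_eq_mulV (inv_word w); rewrite inv_wordK. Qed.

Lemma word_eq_inv u v : word_eq u v -> word_eq (inv_word u) (inv_word v).
Proof.
move=> uv; apply: (@word_eq_trans (inv_word u ++ (v ++ inv_word v))).
  rewrite -[X in word_eq X _]cats0; apply: word_eq_cat (word_eq_refl _) _.
  exact/word_eq_sym/word_eq_mulV.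
rewrite catA -[X in word_eq _ X]cat0s.
apply: word_eq_cat (word_eq_refl _).
apply: word_eq_trans (word_eq_mulVl u).
by apply: word_eq_cat (word_eq_refl _) (word_eq_sym _).
Qed.

Definition presented_mul (x y : presented_group) : presented_group :=
  word_class (repr x ++ repr y).
Definition presented_one : presented_group := word_class [::].
Definition presented_inv (x : presented_group) : presented_group :=
  word_class (inv_word (repr x)).

Lemma word_class_cat u v :
  word_class (u ++ v) = presented_mul (word_class u) (word_class v).
Proof.
by apply/word_classP/word_eq_sym/word_eq_cat; exact: repr_word_class.
Qed.

Lemma word_class_inv u :
  word_class (inv_word u) = presented_inv (word_class u).
Proof.
by apply/word_classP/word_eq_sym/word_eq_inv; exact: repr_word_class.
Qed.

Lemma presented_mulA : associative presented_mul.
Proof.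
move=> x y z; rewrite -(word_classK x) -(word_classK y) -(word_classK z).
by rewrite -!word_class_cat catA.
Qed.

Lemma presented_mul1 : left_id presented_one presented_mul.
Proof. by move=> x; rewrite -(word_classK x) -word_class_cat. Qed.

Lemma presented_mulr1 : right_id presented_one presented_mul.
Proof. by move=> x; rewrite -(word_classK x) -word_class_cat cats0. Qed.

Lemma presented_mulV : left_inverse presented_one presented_inv presented_mul.
Proof.
move=> x; rewrite -(word_classK x) -word_class_inv -word_class_cat.
exact/word_classP/word_eq_mulVl.
Qed.

Lemma presented_mulrV : right_inverse presented_one presented_inv presented_mul.
Proof.
move=> x; rewrite -(word_classK x) -word_class_inv -word_class_cat.
exact/word_classP/word_eq_mulV.
Qed.

HB.instance Definition _ := isGroup.Build presented_group
  presented_mulA presented_mul1 presented_mulr1 presented_mulV presented_mulrV.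

End Presentation.

Definition raag_rel (V : finType) (E : {set {set V}})
    (u v : seq (V * bool)) : Prop :=
  exists x y : V, [/\ [set x; y]%SET \in E,
    u = [:: (x, true); (y, true)] & v = [:: (y, true); (x, true)]].

Definition raag (V : finType) (E : {set {set V}}) : groupType :=
  presented_group (raag_rel E).

Section Subgroups.
Variable G : groupType.
Implicit Types (A B H : set G) (g : G).

Definition is_subgroup H : Prop :=
  [/\ H 1, forall x y, H x -> H y -> H (x * y) & forall x, H x -> H x^-1].

Definition generated A : set G := smallest is_subgroup A.

Definition set_mulg A B : set G := [set a * b | a in A & b in B].

Definition commutator_subgroup A B : set G :=
  generated [set [~ a, b] | a in A & b in B].

Definition power_subgroup H (q : nat) : set G := generated [set h ^+ q | h in H].

Definition zexpg g (k : int) : G :=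
  match k with Posz m => g ^+ m | Negz m => g ^- m.+1 end.

(* The three series below are meaningful for n >= 1; the term of index 0 is a
   dummy, equal to the term of index 1. *)
Definition lcs (n : nat) : set G :=
  iter n.-1 (fun H => commutator_subgroup H setT) setT.

Definition rational_lcs (n : nat) : set G :=
  [set g | exists2 k : int, k <> 0%R & lcs n (zexpg g k)].

Definition ceil_div (n p : nat) : nat := ((n + p.-1) %/ p)%N.

(* The first argument of pcs_rec only ensures structural termination: when
   p > 1, the recursive calls from n > 1 are at indices in [1, n - 1], so that
   n steps are enough, as p_central_series1 and p_central_seriesE confirm. *)
Fixpoint pcs_rec (p fuel n : nat) : set G :=
  if fuel is fuel'.+1 then
    if (n <= 1)%N then setT
    else set_mulg (commutator_subgroup (pcs_rec p fuel' n.-1) setT)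
                  (power_subgroup (pcs_rec p fuel' (ceil_div n p)) p)
  else setT.

Definition p_central_series (p n : nat) : set G := pcs_rec p n n.

Lemma ceil_div_lt p n : (1 < p)%N -> (1 < n)%N -> (ceil_div n p < n)%N.
Proof.
case: p n => [|[|p]] // [|[|n]] // _ _.
by rewrite /ceil_div ltn_divLR //= mulnC; nia.
Qed.

Lemma pcs_rec_fuel p f f' n : (1 < p)%N -> (n <= f)%N -> (n <= f')%N ->
  pcs_rec p f n = pcs_rec p f' n.
Proof.
move=> p1; elim: f f' n => [|f IHf] [|f'] n //=.
- by rewrite leqn0 => /eqP->.
- by rewrite leqn0 => _ /eqP->.
move=> nf nf'; case: leqP => // n1; have cn := ceil_div_lt p1 n1.
by rewrite (IHf f' n.-1) ?(IHf f' (ceil_div n p)) //; lia.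
Qed.

Lemma p_central_series1 p : p_central_series p 1 = setT.
Proof. by []. Qed.

Lemma p_central_seriesE p n : (1 < p)%N -> (1 < n)%N ->
  p_central_series p n =
  set_mulg (commutator_subgroup (p_central_series p n.-1) setT)
           (power_subgroup (p_central_series p (ceil_div n p)) p).
Proof.
case: n => // n p1 n1; have cn := ceil_div_lt p1 n1.
rewrite /p_central_series [LHS]/= leqNgt n1 /=.
by rewrite (@pcs_rec_fuel p n (ceil_div n.+1 p) (ceil_div n.+1 p)).
Qed.

Definition finitely_generated : Prop :=
  exists2 A : set G, finite_set A & generated A = setT.

Definition torsion_free : Prop :=
  forall g (n : nat), (0 < n)%N -> g ^+ n = 1 -> g = 1.

Definition nilpotent_group : Prop := exists c : nat, lcs c.+1 = [set 1].

Definition finite_p_group (p : nat) : Prop :=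
  exists k : nat, ([set: G] #= `I_(p ^ k)%N)%card.

(* Quotients of G are taken up to isomorphism, as homomorphic images. *)
Definition residually (P : groupType -> Prop) : Prop :=
  forall g, g <> 1 ->
  exists (Q : groupType) (f : {multiplicative G -> Q}),
    [/\ P Q, set_surj setT setT f & f g <> 1].

End Subgroups.

Arguments lcs G n : clear implicits.
Arguments rational_lcs G n : clear implicits.
Arguments p_central_series G p n : clear implicits.

(* Main.v *)
(* Magnus' map sends a generator [v] of the RAAG to [1 + v] in the ring of power
   series in partially commuting variables.  The graded Lie ring of the lower
   central series is generated in degree 1, where adjacent generators commute, so
   the quotients [gamma_n / gamma_(n+1)] are torsion free as soon as the Lie ring
   with this presentation embeds into the associative ring with this presentation.
   That embedding is obtained by Lazard elimination: killing one vertex [v] splits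
   off the Lie ring generated by the elements ad(m) v, where m runs over the traces
   in the other vertices, and killing further letters one at a time, lightest
   first, pushes all the remaining letters to weight > n.  Eliminated letters keep
   acting, by derivations, on the free associative ring on the new letters; this
   shows that no new relation is introduced.

   For the intersections, write [g <> 1] as a reduced product of powers
   [v_1 ^ e_1 ... v_r ^ e_r].  The partial map which deletes the letter [v] from the
   front of a reduced word, up to commutations, defines an operator [X_v] of square
   zero, so [v |-> 1 + X_v] is a representation over [Z / p^k] in which
   [v_i ^ e_i] acts as [1 + e_i X_(v_i)]; the matrix coefficient of [g] between the
   word [v_1 ... v_r] and the empty word is the product of the [e_i].  This
   representation is unipotent for a filtration raised by [p] and by every [X_v], so
   that it kills [gamma_(n,p)] and [gamma_n] for large [n],
     and its image is a finite
   p-group. *)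
From HB Require Import structures.
From mathcomp Require Import fingroup perm pgroup abelian.
From mathcomp Require Import all_boot all_order all_algebra zify ring.
From mathcomp Require Import boolp classical_sets functions cardinality.
Require Import Defs.

Set Implicit Arguments.
Unset Strict Implicit.
Unset Printing Implicit Defensive.

Import GRing.Theory.

Local Open Scope group_scope.
Local Open Scope quotient_scope.

(** * The graded Lie ring of the lower central series *)

Section GroupIdentities.
Variable G : groupType.
Implicit Types x y z : G.

Lemma Hall_Witt x y z :
  [~ x, y^-1, z] ^ y * [~ y, z^-1, x] ^ z * [~ z, x^-1, y] ^ x = 1.
Proof.
(* Each Hall-Witt factor is a quotient of two values of [a] at consecutive cyclic rotations of [x],
   [y], [z], so the product telescopes. *)
pose a x y z : G := x * z * y ^ x.
suffices hw x' y' z' : [~ x', y'^-1, z'] ^ y' = (a x' y' z')^-1 * (a y' z' x').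
  by rewrite !hw; move: a {hw} => a; rewrite 2!mulgA !mulgK mulVg.
by rewrite /a /commg /conjg !gnorm.
Qed.

Lemma commgMl x y z : [~ x * y, z] = [~ x, z] ^ y * [~ y, z].
Proof. by rewrite /commg /conjg !gnorm. Qed.

Lemma commgMr x y z : [~ x, y * z] = [~ x, z] * [~ x, y] ^ z.
Proof. by rewrite /commg /conjg !gnorm. Qed.

Lemma commVg x y : [~ x^-1, y] = [~ x, y]^-1 ^ x^-1.
Proof. by rewrite /commg /conjg !gnorm. Qed.

Lemma commgV x y : [~ x, y^-1] = [~ x, y]^-1 ^ y^-1.
Proof. by rewrite /commg /conjg !gnorm. Qed.

End GroupIdentities.

Section LowerCentralSeries.
Variable G : groupType.
Implicit Types (A H : set G) (x y z g : G).

Lemma sub_generated A : (A `<=` generated A)%classic.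
Proof. by move=> x Ax H [_]; apply. Qed.

Lemma generated_min A H :
  is_subgroup H -> (A `<=` H)%classic -> (generated A `<=` H)%classic.
Proof. by move=> sH AH x; apply. Qed.

Lemma generated_subgroup A : is_subgroup (generated A).
Proof.
split=> [H [[]]//|x y Ax Ay H HA|x Ax H HA].
  by have [[_ HM _] _] := HA; apply: HM; [apply: Ax | apply: Ay].
by have [[_ _ HV] _] := HA; apply: HV; apply: Ax.
Qed.

Lemma lcs_subgroup n : is_subgroup (lcs G n).
Proof. by case: n => [|[|n]] //; apply: generated_subgroup. Qed.

Lemma lcs1 n : lcs G n 1.
Proof. by have [] := lcs_subgroup n. Qed.

Lemma lcsM n x y : lcs G n x -> lcs G n y -> lcs G n (x * y).
Proof. by have [_ + _] := lcs_subgroup n; apply. Qed.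

Lemma lcsV n x : lcs G n x -> lcs G n x^-1.
Proof. by have [_ _] := lcs_subgroup n; apply. Qed.

Lemma lcsX n k x : lcs G n x -> lcs G n (x ^+ k).
Proof. by move=> Gx; elim: k => [|k IHk]; [exact: lcs1 | rewrite expgS; apply:
  lcsM]. Qed.

Lemma commg_lcs n x y : lcs G n x -> lcs G n.+1 [~ x, y].
Proof. by case: n => // n Gx; apply: sub_generated; exists x => //; exists y. Qed.

Lemma lcsJ n x y : lcs G n x -> lcs G n (x ^ y).
Proof.
elim: n x y => [|[|n] IHn] // x y.
apply: (@generated_min _ [set x | lcs G n.+2 (x ^ y)]%classic).
  split=> [|u v /= Gu Gv|u /= Gu].
  - by rewrite /= conj1g; apply: lcs1.
  - by rewrite conjMg; apply: lcsM.
  - by rewrite conjVg; apply: lcsV.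
move=> _ [u Gu [v _ <-]] /=.
by rewrite conjRg; apply: commg_lcs; apply: IHn.
Qed.

Lemma lcs_conj n x y : lcs G n (x ^ y) <-> lcs G n x.
Proof. by split=> [/(lcsJ y^-1)|/lcsJ//]; rewrite conjgK. Qed.

Lemma lcsS n x : lcs G n.+1 x -> lcs G n x.
Proof.
case: n => // n; apply: generated_min; first exact: lcs_subgroup.
move=> _ [u Gu [v _ <-]]; rewrite commgEl.
by apply: lcsM; [apply: lcsV | apply: lcsJ].
Qed.

Lemma lcs_le m n x : (m <= n)%N -> lcs G n x -> lcs G m x.
Proof. by move/subnK <-; elim: (n - m)%N => // k IHk /lcsS/IHk. Qed.

(** Three subgroups argument: [lcs G n.+2] is generated by commutators [[~ u, v]], and Hall-Witt
    rewrites [[~ u, v, x]], up to conjugation, through [[~ v^-1, x^-1, u]] and [[~ x, u^-1, v^-1]].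
    Induction on [n], with [m] varying, handles both. *)
Lemma commg_lcs_lcs m n x y :
  lcs G m x -> lcs G n y -> lcs G (m + n) [~ x, y].
Proof.
elim: n m x y => [|[|n] IHn] m x y Gx.
- by rewrite addn0 => _; apply/lcsS/commg_lcs.
- by rewrite addn1 => _; apply: commg_lcs.
apply: (@generated_min _ [set y | lcs G (m + n.+2) [~ x, y]]%classic).
  split=> [|u v /= Gu Gv|u /= Gu].
  - by rewrite /= commg1; apply: lcs1.
  - by rewrite commgMr; apply: lcsM => //; apply: lcsJ.
  - by rewrite commgV; apply/lcsJ/lcsV.
move=> _ [u Gu [v _ <-]] /=; rewrite -invgR; apply: lcsV.
apply/(lcs_conj _ _ v^-1); have := Hall_Witt u v^-1 x.
rewrite invgK -mulgA => /mulg1_eq HW; rewrite -[X in lcs _ _ X]invgK HW.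
have Gxv : lcs G m.+1 [~ v^-1, x^-1].
  by rewrite -invgR; apply: lcsV; apply: commg_lcs; apply: lcsV.
apply: lcsV; apply: lcsM; apply: lcsJ.
  by rewrite addnS -addSn; apply: IHn.
by rewrite addnS; apply: commg_lcs; apply: IHn => //; apply: lcsV.
Qed.

End LowerCentralSeries.

(** * The quotients gamma_n / gamma_(n+1) as additive groups *)

Section GradedQuotient.
Variables (G : groupType) (n : nat).
Implicit Types x y z : G.

Definition lcs_elt : Type := {x : G | `[< lcs G n x >]}.
HB.instance Definition _ := [isSub of lcs_elt for @sval _ _].
HB.instance Definition _ := [Choice of lcs_elt by <:].

Definition lcs_congr : rel lcs_elt :=
  fun u v => `[< lcs G n.+1 ((val u)^-1 * val v) >].

Lemma lcs_congr_refl : reflexive lcs_congr.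
Proof. by move=> u; apply/asboolP; rewrite mulVg; apply: lcs1. Qed.

Lemma lcs_congr_sym : symmetric lcs_congr.
Proof.
by move=> u v; apply/asboolP/asboolP=> /lcsV; rewrite invgM invgK.
Qed.

Lemma lcs_congr_trans : transitive lcs_congr.
Proof.
move=> v u w /asboolP uv /asboolP vw; apply/asboolP.
by have := lcsM uv vw; rewrite mulgA mulgK.
Qed.

Canonical lcs_congr_equiv :=
  EquivRel lcs_congr lcs_congr_refl lcs_congr_sym lcs_congr_trans.

Definition gr : Type := {eq_quot lcs_congr_equiv}.
HB.instance Definition _ := Choice.on gr.
HB.instance Definition _ := Quotient.on gr.

Lemma lcs_elt_one : `[< lcs G n 1 >].
Proof. exact/asboolP/lcs1. Qed.

(* Only meaningful for [x] in [lcs G n]. *)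
Definition grc x : gr := \pi_gr (insubd (Sub 1 lcs_elt_one : lcs_elt) x).

Definition gr_val (a : gr) : G := val (repr a).

Lemma gr_valP a : lcs G n (gr_val a).
Proof. by apply/asboolP; exact: (valP (repr a)). Qed.

Lemma gr_valK a : grc (gr_val a) = a.
Proof.
rewrite /grc /gr_val -[RHS]reprK; congr (\pi_gr _).
by apply: val_inj; rewrite val_insubd (valP (repr a)).
Qed.

Lemma eq_grc x y : lcs G n x -> lcs G n y ->
  grc x = grc y <-> lcs G n.+1 (x^-1 * y).
Proof.
move=> Gx Gy; rewrite /grc; set u := insubd _ x; set v := insubd _ y.
have ux : val u = x by rewrite val_insubd asboolT.
have vy : val v = y by rewrite val_insubd asboolT.
rewrite -ux -vy; split=> [/eqmodP/asboolP //|uv].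
by apply/eqmodP; apply/asboolP.
Qed.

Lemma gr_val_grc x : lcs G n x -> lcs G n.+1 ((gr_val (grc x))^-1 * x).
Proof. by move=> Gx; apply/eq_grc => //; [apply: gr_valP | apply: gr_valK]. Qed.

Definition gr_add (a b : gr) := grc (gr_val a * gr_val b).
Definition gr_opp (a : gr) := grc (gr_val a)^-1.

Lemma gr_add_grc x y : lcs G n x -> lcs G n y ->
  gr_add (grc x) (grc y) = grc (x * y).
Proof.
move=> Gx Gy; have [Gx' Gy'] := (gr_valP (grc x), gr_valP (grc y)).
apply/eq_grc; [exact: lcsM | exact: lcsM | rewrite invgM].
have -> : forall a b : G, b^-1 * a^-1 * (x * y) = (a^-1 * x) ^ b * (b^-1 * y).
  by move=> a b; rewrite /conjg !gnorm.
by apply: lcsM; [apply: lcsJ|]; apply: gr_val_grc.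
Qed.

Lemma gr_opp_grc x : lcs G n x -> gr_opp (grc x) = grc x^-1.
Proof.
move=> Gx; have Gx' := gr_valP (grc x).
apply/eq_grc; [exact: lcsV | exact: lcsV | rewrite invgK].
set a := gr_val _ in Gx' *; have -> : a * x^-1 = ((a^-1 * x) ^ a^-1)^-1.
  by rewrite /conjg !gnorm.
by apply/lcsV/lcsJ/gr_val_grc.
Qed.

Lemma gr_addA : associative gr_add.
Proof.
move=> a b c; rewrite -(gr_valK a) -(gr_valK b) -(gr_valK c).
have [[Ga Gb] Gc] := (gr_valP a, gr_valP b, gr_valP c).
rewrite (gr_add_grc Gb Gc) (gr_add_grc Ga Gb) !gr_add_grc ?mulgA //; exact: lcsM.
Qed.

Lemma gr_addC : commutative gr_add.
Proof.
move=> a b; rewrite -(gr_valK a) -(gr_valK b).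
have [Ga Gb] := (gr_valP a, gr_valP b).
rewrite !gr_add_grc //; apply/eq_grc; [exact: lcsM | exact: lcsM |].
by rewrite invgM -mulgA; exact: commg_lcs.
Qed.

Lemma gr_add0 : left_id (grc 1) gr_add.
Proof.
move=> a; rewrite -(gr_valK a) gr_add_grc ?mul1g //; first exact: lcs1.
exact: gr_valP.
Qed.

Lemma gr_addN : left_inverse (grc 1) gr_opp gr_add.
Proof.
move=> a; rewrite -(gr_valK a); have Ga := gr_valP a.
by rewrite gr_opp_grc // gr_add_grc ?mulVg //; apply: lcsV.
Qed.

HB.instance Definition _ := GRing.isZmodule.Build gr gr_addA gr_addC gr_add0
  gr_addN.

Lemma grc1 : grc 1 = 0%R. Proof. by []. Qed.

Lemma grcM x y : lcs G n x -> lcs G n y -> grc (x * y) = (grc x + grc y)%R.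
Proof. by move=> Gx Gy; rewrite -gr_add_grc. Qed.

Lemma grcV x : lcs G n x -> grc x^-1 = (- grc x)%R.
Proof. by move=> Gx; rewrite -gr_opp_grc. Qed.

Lemma grcX x k : lcs G n x -> grc (x ^+ k) = (grc x *+ k)%R.
Proof.
move=> Gx; elim: k => [|k IHk] //.
by rewrite expgS mulrS grcM ?IHk //; apply: lcsX.
Qed.

Lemma grc_eq0 x : lcs G n x -> grc x = 0%R <-> lcs G n.+1 x.
Proof.
move=> Gx; split=> [|Gx'].
  by rewrite -grc1 => /esym/eq_grc; rewrite invg1 mul1g; apply => //; apply: lcs1.
by rewrite -grc1; apply/esym/eq_grc => //; [apply: lcs1 | rewrite invg1 mul1g].
Qed.

Lemma grcJ x y : lcs G n x -> grc (x ^ y) = grc x.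
Proof.
move=> Gx; apply/esym/eq_grc => //; first exact: lcsJ.
by rewrite -commgEl; apply: commg_lcs.
Qed.

End GradedQuotient.

Section GradedBracket.
Variable G : groupType.
Implicit Types x y z : G.

(** Conjugation acts trivially on the graded quotients, which makes commutators bilinear there. The
    degree is a variable [k] with an equation, so that differently bracketed sums share the type
    [gr G k]. *)
Lemma grc_commMl m n k x y z : k = (m + n)%N ->
  lcs G m x -> lcs G m y -> lcs G n z ->
  grc k [~ x * y, z] = (grc k [~ x, z] + grc k [~ y, z])%R.
Proof.
move=> -> Gx Gy Gz; have [Gxz Gyz] := (commg_lcs_lcs Gx Gz, commg_lcs_lcs Gy Gz).
by rewrite commgMl grcM ?grcJ //; apply: lcsJ.
Qed.

Lemma grc_commMr m n k x y z : k = (m + n)%N ->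
  lcs G m x -> lcs G n y -> lcs G n z ->
  grc k [~ x, y * z] = (grc k [~ x, y] + grc k [~ x, z])%R.
Proof.
move=> -> Gx Gy Gz; have [Gxy Gxz] := (commg_lcs_lcs Gx Gy, commg_lcs_lcs Gx Gz).
by rewrite commgMr grcM ?grcJ 1?addrC //; apply: lcsJ.
Qed.

Lemma grc_commVl m n k x y : k = (m + n)%N -> lcs G m x -> lcs G n y ->
  grc k [~ x^-1, y] = (- grc k [~ x, y])%R.
Proof.
move=> -> Gx Gy; have Gxy := commg_lcs_lcs Gx Gy.
by rewrite commVg grcJ ?grcV //; apply: lcsV.
Qed.

Lemma grc_commVr m n k x y : k = (m + n)%N -> lcs G m x -> lcs G n y ->
  grc k [~ x, y^-1] = (- grc k [~ x, y])%R.
Proof.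
move=> -> Gx Gy; have Gxy := commg_lcs_lcs Gx Gy.
by rewrite commgV grcJ ?grcV //; apply: lcsV.
Qed.

Lemma grc_commC m n k x y : k = (m + n)%N -> lcs G m x -> lcs G n y ->
  grc k [~ x, y] = (- grc k [~ y, x])%R.
Proof.
by move=> -> Gx Gy; rewrite -grcV ?invgR // addnC; apply: commg_lcs_lcs.
Qed.

(** By bilinearity the two sides differ by commutators with [x^-1 * x'] or [y^-1 * y'], which lie
    one term deeper. The Lie bracket is thus well defined on classes. *)
Lemma grc_comm_eq m n k x y x' y' : k = (m + n)%N ->
  lcs G m x -> lcs G m x' -> lcs G n y -> lcs G n y' ->
  grc m x = grc m x' -> grc n y = grc n y' ->
  grc k [~ x, y] = grc k [~ x', y'].
Proof.
move=> -> Gx Gx' Gy Gy' /(eq_grc Gx Gx') xx' /(eq_grc Gy Gy') yy'.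
rewrite -[x'](mulVKg x) -[y'](mulVKg y).
have [Gdx Gdy] := (lcsS xx', lcsS yy').
rewrite (grc_commMl (erefl _) Gx Gdx) ?mulVKg //.
have /grc_eq0 -> : lcs G (m + n).+1 [~ x^-1 * x', y'] by exact: (commg_lcs_lcs xx').
  rewrite addr0 -[y'](mulVKg y) (grc_commMr (erefl _) Gx Gy) //.
  have /grc_eq0 -> : lcs G (m + n).+1 [~ x, y^-1 * y'].
    by rewrite -addnS; apply: commg_lcs_lcs.
    by rewrite addr0.
  exact: commg_lcs_lcs.
exact: commg_lcs_lcs.
Qed.

Lemma grc_Jacobi m n p k x y z : k = (m + n + p)%N ->
  lcs G m x -> lcs G n y -> lcs G p z ->
  grc k [~ x, [~ y, z]] = (grc k [~ [~ x, y], z] - grc k [~ [~ x, z], y])%R.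
Proof.
move=> kE Gx Gy Gz.
have sum0 : (grc k [~ x, y, z] + (grc k [~ y, z, x] + grc k [~ z, x, y]) = 0)%R.
  (* In degree [k] the outer conjugation disappears and the inverse of [b] contributes a sign, so
     the Hall-Witt product becomes the sum of three brackets. *)
  have swap a b c ma mb mc : k = (ma + mb + mc)%N ->
      lcs G ma a -> lcs G mb b -> lcs G mc c ->
      lcs G k ([~ a, b^-1, c] ^ b) /\
      grc k ([~ a, b^-1, c] ^ b) = (- grc k [~ a, b, c])%R.
    move=> -> Ga Gb Gc; have Gab := commg_lcs_lcs Ga Gb.
    have Gab' := commg_lcs_lcs Ga (lcsV Gb).
    have Gabc := commg_lcs_lcs Gab' Gc; split; first exact: lcsJ.
    rewrite grcJ // (grc_comm_eq (erefl _) Gab' (lcsV Gab) Gc Gc) //.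
      exact: (grc_commVl (erefl _) Gab Gc).
    by rewrite (grc_commVr (erefl _) Ga Gb) grcV.
  have [|Gxyz xyz] := swap x y z m n p _ Gx Gy Gz; first by [].
  have [|Gyzx yzx] := swap y z x n p m _ Gy Gz Gx; first by lia.
  have [|Gzxy zxy] := swap z x y p m n _ Gz Gx Gy; first by lia.
  apply/oppr_inj; rewrite oppr0 !opprD -xyz -yzx -zxy addrA.
  by rewrite -(grcM Gxyz Gyzx) -(grcM (lcsM Gxyz Gyzx) Gzxy) Hall_Witt.
have -> : grc k [~ x, [~ y, z]] = (- grc k [~ y, z, x])%R.
  apply: (@grc_commC m (n + p)%N) => //; first by lia.
  exact: commg_lcs_lcs.
have zxy : grc k [~ z, x, y] = (- grc k [~ x, z, y])%R.
  have kE' : k = (p + m + n)%N by lia.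
  have Gzx := commg_lcs_lcs Gz Gx; have Gxz := commg_lcs_lcs Gx Gz.
  rewrite addnC in Gxz.
  rewrite (grc_comm_eq kE' Gzx (lcsV Gxz) Gy Gy (congr1 _ (esym (invgR _ _)))) //.
  exact: (grc_commVl kE' Gxz Gy).
by rewrite -zxy; apply/oppr_inj/eqP; rewrite opprK -addr_eq0 addrC addrAC -addrA
  sum0.
Qed.

End GradedBracket.

(** * Lie terms and elimination *)

Section ZmodMorphism.
Variables (M N : zmodType) (f : M -> N).
Hypothesis f_add : zmod_morphism f.

Lemma zmod_morphism0 : f 0%R = 0%R.
Proof. by rewrite -[X in f X](subrr 0%R) f_add subrr. Qed.

Lemma zmod_morphismN u : f (- u)%R = (- f u)%R.
Proof. by rewrite -[in LHS]sub0r f_add zmod_morphism0 sub0r. Qed.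

Lemma zmod_morphismD u v : f (u + v)%R = (f u + f v)%R.
Proof. by rewrite -[v in LHS]opprK f_add zmod_morphismN opprK. Qed.

End ZmodMorphism.

(** Lie elements remain syntax, not divided by the Lie identities, so that one term can be read in a
    group through [eval] and as an operator through [act]. *)
Inductive lie_term (I : Type) : Type :=
| Gen of I
| Zero
| Add of lie_term I & lie_term I
| Opp of lie_term I
| Br of lie_term I & lie_term I.
Arguments Zero {I}.

Section LieTerms.
Variable I : Type.
Implicit Types U T : lie_term I.

Fixpoint homogeneous (wt : I -> nat) n T : Prop :=
  match T with
  | Gen i => wt i = n
  | Zero => True
  | Add U T => homogeneous wt n U /\ homogeneous wt n T
  | Opp U => homogeneous wt n U
  | Br U T => exists a b, [/\ n = (a + b)%N,
    homogeneous wt a U & homogeneous wt b T]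
  end.

Fixpoint letters_in (A : I -> Prop) T : Prop :=
  match T with
  | Gen i => A i
  | Zero => True
  | Opp U => letters_in A U
  | Add U T | Br U T => letters_in A U /\ letters_in A T
  end.

Fixpoint eval (G : groupType) (el : I -> G) T : G :=
  match T with
  | Gen i => el i
  | Zero => 1
  | Add U T => eval el U * eval el T
  | Opp U => (eval el U)^-1
  | Br U T => [~ eval el U, eval el T]
  end.

Fixpoint act (M : zmodType) (m : I -> M -> M) T (v : M) : M :=
  match T with
  | Gen i => m i v
  | Zero => 0%R
  | Add U T => (act m U v + act m T v)%R
  | Opp U => (- act m U v)%R
  | Br U T => (act m U (act m T v) - act m T (act m U v))%R
  end.

Fixpoint kill (H : pred I) T : lie_term I :=
  match T with
  | Gen i => if H i then Gen i else Zero
  | Zero => Zero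
  | Add U T => Add (kill H U) (kill H T)
  | Opp U => Opp (kill H U)
  | Br U T => Br (kill H U) (kill H T)
  end.

Lemma act_additive (M : zmodType) (m : I -> M -> M) :
  (forall i, zmod_morphism (m i)) -> forall T, zmod_morphism (act m T).
Proof.
move=> m_add; elim=> [i||U IHU T IHT|U IHU|U IHU T IHT] u v /=.
- exact: m_add.
- by rewrite subr0.
- by rewrite IHU IHT opprD addrACA.
- by rewrite IHU opprB opprK addrC.
- by rewrite IHT !IHU IHT !opprB addrACA [RHS]addrACA; congr (_ + _)%R;
  rewrite addrC.
Qed.

Lemma homogeneous_kill wt n (H : pred I) T : homogeneous wt n T ->
  homogeneous wt n (kill H T).
Proof.
elim: T n => [i||U IHU T IHT|U IHU|U IHU T IHT] n //=; first by case: (H i).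
- by case=> /IHU ? /IHT.
- by move/IHU.
- by case=> a [b [-> /IHU ? /IHT ?]]; exists a, b.
Qed.

Lemma letters_in_kill (A : I -> Prop) (H : pred I) T :
  letters_in A T -> letters_in (fun i => H i /\ A i) (kill H T).
Proof.
elim: T => [i||U IHU T IHT|U IHU|U IHU T IHT] //=.
- by case: ifP.
- by case=> /IHU ? /IHT.
- by case=> /IHU ? /IHT.
Qed.

Lemma letters_in_sub (A B : I -> Prop) T :
  (forall i, A i -> B i) -> letters_in A T -> letters_in B T.
Proof.
move=> AB; elim: T => [i||U IHU T IHT|U IHU|U IHU T IHT] //=.
- exact: AB.
- by case=> /IHU ? /IHT.
- by case=> /IHU ? /IHT.
Qed.

Lemma letters_in_true T : letters_in (fun=> True) T.
Proof. by elim: T. Qed.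

Lemma eq_act (M : zmodType) (m m' : I -> M -> M) (A : I -> Prop) T :
  (forall i, A i -> m i = m' i) -> letters_in A T -> act m T = act m' T.
Proof.
move=> mm'; elim: T => [i||U IHU T IHT|U IHU|U IHU T IHT] //=.
- by move=> /mm' ->.
- by case=> /IHU -> /IHT ->.
- by move=> /IHU ->.
- by case=> /IHU -> /IHT ->.
Qed.

Lemma act_kill (M : zmodType) (m : I -> M -> M) (H : pred I) T :
  (forall i, ~~ H i -> m i = fun=> 0%R) -> act m (kill H T) = act m T.
Proof.
move=> mH; elim: T => [i||U IHU T IHT|U IHU|U IHU T IHT] //=.
- by case: ifPn => //= /mH ->.
- by rewrite IHU IHT.
- by rewrite IHU.
- by rewrite IHU IHT.
Qed.

End LieTerms.

Section LieTermsInGroups.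
Variables (G : groupType) (I : Type) (wt : I -> nat) (el : I -> G).
Hypothesis el_lcs : forall i, lcs G (wt i) (el i).

Lemma eval_lcs n T : homogeneous wt n T -> lcs G n (eval el T).
Proof.
elim: T n => [i||U IHU T IHT|U IHU|U IHU T IHT] n /=.
- by move<-.
- by move=> _; apply: lcs1.
- by case=> /IHU ? /IHT; apply: lcsM.
- by move/IHU; apply: lcsV.
- by case=> a [b [-> /IHU ? /IHT ?]]; apply: commg_lcs_lcs.
Qed.

Definition symbol n T : gr G n := grc n (eval el T).

Lemma symbolD n U T : homogeneous wt n U -> homogeneous wt n T ->
  symbol n (Add U T) = (symbol n U + symbol n T)%R.
Proof. by move=> /eval_lcs GS /eval_lcs GT; rewrite /symbol grcM. Qed.

Lemma symbolN n U : homogeneous wt n U -> symbol n (Opp U) = (- symbol n U)%R.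
Proof. by move=> /eval_lcs GS; rewrite /symbol grcV. Qed.

Lemma symbol_eq0 n T : homogeneous wt n T -> symbol n T = 0%R <->
  lcs G n.+1 (eval el T).
Proof. by move=> /eval_lcs; apply: grc_eq0. Qed.

End LieTermsInGroups.

(* Operators on functions on words: [lmul u] is (dual to) left multiplication by
   the letter [u], and [word_deriv phi] is (dual to) the derivation of the free
   associative ring which extends [phi], where [None] stands for [0]. *)
Section WordOperators.
Variable J : Type.
Implicit Types (f : seq J -> int) (phi : J -> option J) (w : seq J).

Definition lmul (u : J) f : seq J -> int := fun w => f (u :: w).

Fixpoint word_deriv_at phi w f : int :=
  if w is a :: w' then
    ((if phi a is Some b then f (b :: w') else 0) + word_deriv_at phi w' (lmul a
      f))%R
  else 0%R.

Definition word_deriv phi f : seq J -> int := fun w => word_deriv_at phi w f.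

Lemma lmul_additive u : zmod_morphism (lmul u).
Proof. by []. Qed.

Lemma word_deriv_additive phi : zmod_morphism (word_deriv phi).
Proof.
move=> f g; apply/funext=> w; rewrite /word_deriv !fctE.
elim: w f g => [|a w IHw] f g /=; first by rewrite subr0.
by rewrite IHw; case: (phi a) => [b|]; rewrite ?fctE; ring.
Qed.

(** Transposed Leibniz rule: the commutator of a derivation with multiplication by [u] is
    multiplication by the image of [u]. Transposition reverses the order of the two operators. *)
Lemma lmul_word_deriv phi u f :
  (lmul u (word_deriv phi f) - word_deriv phi (lmul u f)
   = if phi u is Some b then lmul b f else 0)%R.
Proof.
apply/funext=> w; rewrite /lmul /word_deriv !fctE /= addrK.
by case: (phi u).
Qed.

End WordOperators.

Section Elimination.
Variables (G : groupType) (I J : Type).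
Variables (wt : I -> nat) (el : I -> G) (wt' : J -> nat) (el' : J -> G).
Variables (H : pred I) (A : I -> Prop) (A' : J -> Prop).
Variables (beta : I -> J) (phi : I -> J -> option J).

Hypothesis el_lcs : forall i, lcs G (wt i) (el i).
Hypothesis el'_lcs : forall u, lcs G (wt' u) (el' u).
Hypothesis betaP : forall y, ~~ H y -> A y ->
  [/\ A' (beta y), wt' (beta y) = wt y & el' (beta y) = el y].
Hypothesis phiP : forall h u, H h -> A h -> A' u ->
  if phi h u is Some u' then
    [/\ A' u', wt' u' = (wt' u + wt h)%N
      & grc (wt' u') (el' u') = grc (wt' u') [~ el' u, el h]]
  else grc (wt' u + wt h) [~ el' u, el h] = 0%R.

(** Semidirect decomposition: letters in [H] survive and act by derivations on the free ring over
    [J]; any other letter [y] turns into the new letter [beta y] and acts by multiplication. The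
    letter [phi h u] stands for the bracket of [u] with [h]. *)
Let D i := word_deriv (phi i).
Let tau i := if H i then D i else lmul (beta i).

Lemma D_additive h : zmod_morphism (D h).
Proof. exact: word_deriv_additive. Qed.

Lemma actD_additive T : zmod_morphism (act D T).
Proof. by apply: act_additive => i; apply: word_deriv_additive. Qed.

Lemma actL_additive T : zmod_morphism (act (@lmul J) T).
Proof. by apply: act_additive => i; apply: lmul_additive. Qed.

(** The bracket of [U] with [K] stays in the ideal spanned by the new letters. Its class and its
    operator are tracked together, because vanishing will be transferred from operators to classes.
    The induction is on [K], then on [U] when [K] is a letter. *)
Lemma bracket_eliminated a b n K U : n = (b + a)%N ->
  letters_in (fun i => H i /\ A i) K -> homogeneous wt a K -> letters_in A' U ->
    homogeneous wt' b U ->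
  exists U', [/\ homogeneous wt' n U', letters_in A' U',
    symbol el' n U' = grc n [~ eval el' U, eval el K]
    & forall f, act (@lmul J) U' f
        = (act (@lmul J) U (act D K f) - act D K (act (@lmul J) U f))%R].
Proof.
move=> ->; elim: K a b U => [h||K1 IH1 K2 IH2|K IHK|K1 IH1 K2 IH2] a b U /=.
- case=> Hh Ah <- {a}.
  elim: U b => [u||U1 IH1 U2 IH2|U IHU|U1 IH1 U2 IH2] b /=.
  + move=> A'u <-; have := phiP Hh Ah A'u.
    case E: (phi h u) => [u'|].
      case=> A'u' wtu' elu'; exists (Gen u'); split=> //=.
        by rewrite -wtu' -elu'.
      by move=> f; rewrite lmul_word_deriv E.
    by move=> el0; exists Zero; split=> //= f; rewrite lmul_word_deriv E.
  + move=> _ _; exists Zero; split=> //=; first by rewrite comm1g.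
    by move=> f; rewrite (zmod_morphism0 (D_additive _)) subr0.
  + case=> over1 over2 [hom1 hom2].
    have [U1' [hom1' over1' sym1 act1]] := IH1 _ over1 hom1.
    have [U2' [hom2' over2' sym2 act2]] := IH2 _ over2 hom2.
    exists (Add U1' U2'); split=> //=.
      rewrite (symbolD el'_lcs) // sym1 sym2.
      by rewrite (grc_commMl (erefl _) (eval_lcs el'_lcs hom1) (eval_lcs el'_lcs
        hom2)).
    move=> f; rewrite act1 act2 (zmod_morphismD (D_additive _)).
    by rewrite opprD addrACA.
  + move=> overU homU; have [U' [homU' overU' symU actU]] := IHU _ overU homU.
    exists (Opp U'); split=> //=.
      rewrite (symbolN el'_lcs) // symU.
      by rewrite (grc_commVl (erefl _) (eval_lcs el'_lcs homU)).
    move=> f; rewrite actU (zmod_morphismN (D_additive _)).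
    by rewrite opprB opprK addrC.
  (* Leibniz form of Jacobi: [[[U1, U2], h] = [[U1, h], U2] + [U1, [U2, h]]]. *)
  + case=> over1 over2 [b1 [b2 [-> hom1 hom2]]].
    have [U1' [hom1' over1' sym1 act1]] := IH1 _ over1 hom1.
    have [U2' [hom2' over2' sym2 act2]] := IH2 _ over2 hom2.
    have [G1 G2] := (eval_lcs el'_lcs hom1, eval_lcs el'_lcs hom2).
    exists (Add (Br U1' U2) (Br U1 U2')); split=> //=.
    * split; first by exists (b1 + wt h)%N, b2; split=> //; lia.
      by exists b1, (b2 + wt h)%N; split=> //; lia.
    * rewrite (symbolD el'_lcs) /=; first last.
      - by exists b1, (b2 + wt h)%N; split=> //; lia.
      - by exists (b1 + wt h)%N, b2; split=> //; lia.
      rewrite /symbol /= in sym1 sym2 *.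
      have Gh := el_lcs h; have [G1' G2'] := (eval_lcs el'_lcs hom1',
        eval_lcs el'_lcs hom2').
      have [G1h G2h] := (commg_lcs_lcs G1 Gh, commg_lcs_lcs G2 Gh).
      have kE : (b1 + b2 + wt h = (b1 + wt h) + b2)%N by lia.
      have kE' : (b1 + b2 + wt h = b1 + (b2 + wt h))%N by lia.
      rewrite (grc_comm_eq kE G1' G1h G2 G2 sym1 erefl).
      rewrite (grc_comm_eq kE' G1 G1 G2' G2h erefl sym2).
      by rewrite (grc_Jacobi (erefl _) G1 G2 Gh) addrC subrK.
    * move=> f; rewrite act1 act2 !act1 act2.
      rewrite (D_additive _) !(actL_additive _ _ _).
      by apply/funext=> w; rewrite !fctE; ring.
- move=> _ _ overU homU; exists Zero; split=> //=; first by rewrite commg1.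
  by move=> f; rewrite (zmod_morphism0 (actL_additive _)) subrr.
- case=> over1 over2 [hom1 hom2] overU homU.
  have [U1' [hom1' over1' sym1 act1]] := IH1 _ _ _ over1 hom1 overU homU.
  have [U2' [hom2' over2' sym2 act2]] := IH2 _ _ _ over2 hom2 overU homU.
  exists (Add U1' U2'); split=> //=.
    rewrite (symbolD el'_lcs) // sym1 sym2.
    by rewrite (grc_commMr (erefl _) (eval_lcs el'_lcs homU)
         (eval_lcs el_lcs hom1) (eval_lcs el_lcs hom2)).
  move=> f; rewrite act1 act2 (zmod_morphismD (actL_additive _)).
  by rewrite opprD addrACA.
- move=> overK homK overU homU.
  have [U' [homU' overU' symU actU]] := IHK _ _ _ overK homK overU homU.
  exists (Opp U'); split=> //=.
    rewrite (symbolN el'_lcs) // symU.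
    by rewrite (grc_commVr (erefl _) (eval_lcs el'_lcs homU) (eval_lcs el_lcs
      homK)).
  move=> f; rewrite actU (zmod_morphismN (actL_additive _)).
  by rewrite opprB opprK addrC.
(* Here Jacobi reads [[U, [K1, K2]] = [[U, K1], K2] - [[U, K2], K1]]. *)
- case=> over1 over2 [a1 [a2 [-> hom1 hom2]]] overU homU.
  have [U1 [homU1 overU1 sym1 act1]] := IH1 _ _ _ over1 hom1 overU homU.
  have [U2 [homU2 overU2 sym2 act2]] := IH2 _ _ _ over2 hom2 overU homU.
  have [U12 [homU12 overU12 sym12 act12]] := IH2 _ _ _ over2 hom2 overU1 homU1.
  have [U21 [homU21 overU21 sym21 act21]] := IH1 _ _ _ over1 hom1 overU2 homU2.
  have nE1 : (b + (a1 + a2) = b + a1 + a2)%N by lia.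
  have nE2 : (b + (a1 + a2) = b + a2 + a1)%N by lia.
  rewrite -nE1 in homU12 sym12; rewrite -nE2 in homU21 sym21.
  exists (Add U12 (Opp U21)); split=> //=.
    rewrite (symbolD el'_lcs) // (symbolN el'_lcs) // sym12 sym21.
    have GU := eval_lcs el'_lcs homU.
    have [G1 G2] := (eval_lcs el_lcs hom1, eval_lcs el_lcs hom2).
    have [GU1 GU2] := (eval_lcs el'_lcs homU1, eval_lcs el'_lcs homU2).
    rewrite (grc_comm_eq nE1 GU1 (commg_lcs_lcs GU G1) G2 G2 sym1 erefl).
    rewrite (grc_comm_eq nE2 GU2 (commg_lcs_lcs GU G2) G1 G1 sym2 erefl).
    by rewrite (grc_Jacobi nE1 GU G1 G2).
  move=> f; rewrite act12 act21 !act1 !act2.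
  rewrite !(actD_additive _ _ _) !(actL_additive _ _ _).
  by apply/funext=> w; rewrite !fctE; ring.
Qed.

(** Splits [T] along the semidirect product into its surviving part and a part in the ideal of the
    eliminated letters, with the same [T'] serving for classes and for operators. *)
Lemma eliminate n T : letters_in A T -> homogeneous wt n T ->
  exists T', [/\ homogeneous wt' n T', letters_in A' T',
    symbol el n T = (symbol el n (kill H T) + symbol el' n T')%R
    & forall f, act tau T f = (act D (kill H T) f + act (@lmul J) T' f)%R].
Proof.
elim: T n => [i||T1 IH1 T2 IH2|T IHT|T1 IH1 T2 IH2] n /=.
- move=> Ai wti; rewrite /tau; case: ifPn => Hi.
    by exists Zero; split=> //= [|f]; rewrite addr0.
  have [A'i wt'i el'i] := betaP Hi Ai; exists (Gen (beta i)); split=> //=.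
  + by rewrite wt'i.
  + by rewrite /symbol /= el'i grc1 add0r.
  + by move=> f; rewrite add0r.
- by exists Zero; split=> //=; rewrite /symbol /= !grc1 addr0.
- case=> over1 over2 [hom1 hom2].
  have [T1' [hom1' over1' sym1 act1]] := IH1 _ over1 hom1.
  have [T2' [hom2' over2' sym2 act2]] := IH2 _ over2 hom2.
  have [homK1 homK2] := (homogeneous_kill H hom1, homogeneous_kill H hom2).
  exists (Add T1' T2'); split=> //=.
    by rewrite (symbolD el_lcs) // sym1 sym2 (symbolD el_lcs) // (symbolD el'_lcs)
      // addrACA.
  by move=> f; rewrite act1 act2 addrACA.
- move=> overT homT; have [T' [homT' overT' symT actT]] := IHT _ overT homT.
  exists (Opp T'); split=> //=.
    rewrite (symbolN el_lcs) // symT (symbolN el_lcs) ?(symbolN el'_lcs) ?opprD //.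
    exact: homogeneous_kill.
  by move=> f; rewrite actT opprD.
- case=> over1 over2 [a [b [-> hom1 hom2]]].
  have [T1' [hom1' over1' sym1 act1]] := IH1 _ over1 hom1.
  have [T2' [hom2' over2' sym2 act2]] := IH2 _ over2 hom2.
  have [homK1 homK2] := (homogeneous_kill H hom1, homogeneous_kill H hom2).
  have [overK1 overK2] := (letters_in_kill H over1, letters_in_kill H over2).
  have [U1 [homU1 overU1 symU1 actU1]] :=
    bracket_eliminated (erefl _) overK2 homK2 over1' hom1'.
  have [U2 [homU2 overU2 symU2 actU2]] :=
    bracket_eliminated (addnC a b) overK1 homK1 over2' hom2'.
  (* Expanding [[K1 + T1', K2 + T2']] leaves, besides [[K1, K2]], the terms [[T1', T2']],
     [[T1', K2]] and [- [T2', K1]]; the last two are [U1] and [- U2]. *)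
  exists (Add (Br T1' T2') (Add U1 (Opp U2))); split=> //=.
  + by split; [exists a, b | split].
  + have homB : homogeneous wt' (a + b) (Br T1' T2') by exists a, b.
    rewrite (symbolD el'_lcs homB) // (symbolD el'_lcs) // (symbolN el'_lcs) //.
    rewrite symU1 symU2 /symbol /=; rewrite /symbol in sym1 sym2.
    have [[G1 G2] [GK1 GK2]] := ((eval_lcs el_lcs hom1, eval_lcs el_lcs hom2),
      (eval_lcs el_lcs homK1, eval_lcs el_lcs homK2)).
    have [G1' G2'] := (eval_lcs el'_lcs hom1', eval_lcs el'_lcs hom2').
    rewrite -(grcM GK1 G1') in sym1; rewrite -(grcM GK2 G2') in sym2.
    rewrite (grc_comm_eq (erefl _) G1 (lcsM GK1 G1') G2 (lcsM GK2 G2') sym1 sym2).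
    rewrite (grc_commMl (erefl _) GK1 G1' (lcsM GK2 G2')).
    rewrite !(grc_commMr (erefl _) _ GK2 G2') //.
    rewrite (grc_commC (erefl _) GK1 G2') -!addrA; congr (_ + _)%R.
    by rewrite addrC -addrA addrCA.
  + move=> f; rewrite act1 act2 act1 act2 actU1 actU2.
    rewrite !(zmod_morphismD (actD_additive _)) !(zmod_morphismD (actL_additive _)).
    by apply/funext=> w; rewrite !fctE; ring.
Qed.

End Elimination.

(** * Free Lie rings *)

(** Universality of the word operators: the coefficient at [j] of the word [w] applied to [v], as a
    function of [w], intertwines [m] with left multiplication. *)
Lemma act_foldl (I J : Type) (m : I -> (J -> int) -> (J -> int)) (j : J)
    (F := fun v (w : seq I) => foldl (fun v i => m i v) v w j) :
  (forall i, zmod_morphism (m i)) ->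
  forall T v, act (@lmul I) T (F v) = F (act m T v).
Proof.
move=> m_add; have F_add : zmod_morphism F.
  move=> u v; apply/funext=> w; rewrite /F !fctE.
  by elim: w u v => [|i w IHw] u v //=; rewrite m_add IHw.
elim=> [i||T1 IH1 T2 IH2|T IHT|T1 IH1 T2 IH2] v /=.
- by [].
- by rewrite (zmod_morphism0 F_add).
- by rewrite IH1 IH2 (zmod_morphismD F_add).
- by rewrite IHT (zmod_morphismN F_add).
- by rewrite IH2 IH1 IH1 IH2 F_add.
Qed.

(* [T] vanishes in the free associative ring on [I], hence in every ring. *)
Definition null (I : Type) (T : lie_term I) : Prop :=
  forall f, act (@lmul I) T f [::] = 0%R.

Lemma null_act (I J : Type) (m : I -> (J -> int) -> (J -> int)) T v :
  (forall i, zmod_morphism (m i)) -> null T -> act m T v = 0%R.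
Proof.
move=> m_add nullT; apply/funext=> j.
have := nullT (fun w => foldl (fun v i => m i v) v w j).
by rewrite act_foldl.
Qed.

Lemma zmod_morphismMz (M N : zmodType) (f : M -> N) (k : int) u :
  zmod_morphism f -> f (u *~ k)%R = (f u *~ k)%R.
Proof.
move=> f_add; have fMn n : f (u *+ n)%R = (f u *+ n)%R.
  elim: n => [|n IHn]; first exact: zmod_morphism0.
  by rewrite !mulrS (zmod_morphismD f_add) IHn.
by case: k => n; rewrite ?NegzE ?mulrNz ?(zmod_morphismN f_add) -?pmulrn fMn.
Qed.

Lemma fct_mulrz (J : Type) (f : J -> int) (k : int) j : (f *~ k)%R j = (f j *~ k)%R.
Proof.
have fMn n : (f *+ n)%R j = (f j *+ n)%R.
  by elim: n => [|n IHn] //; rewrite !mulrS !fctE IHn.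
by case: k => n; rewrite ?NegzE ?mulrNz ?fctE -?pmulrn fMn.
Qed.

Section OneLetter.
Variables (I : Type) (x : I).
Let A i := i = x.

(** Brackets of [x] with itself vanish, so only a multiple of [x] survives. Its coefficient is
    written as a difference because group powers have natural exponents. The same coefficient
    governs the group and the operators, and so can be read off from the latter. *)
Lemma one_letter (M : zmodType) (m : I -> M -> M) (G : groupType) (el : I -> G) T :
  (forall i, zmod_morphism (m i)) -> letters_in A T ->
  exists a b, eval el T = el x ^+ a / el x ^+ b /\
    forall v, act m T v = (m x v *~ (a%:Z - b%:Z))%R.
Proof.
move=> m_add.
have comm a b c d : commute (el x ^+ a / el x ^+ b) (el x ^+ c / el x ^+ d).
  have cX k : commute (el x ^+ k) (el x ^+ a / el x ^+ b).
    by apply: commuteM; [|apply: commuteV]; apply: commuteX2.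
  apply: commuteM; first exact/commute_sym/cX.
  exact/commuteV/commute_sym/cX.
elim: T => [i||T1 IH1 T2 IH2|T IHT|T1 IH1 T2 IH2] /=.
- by move=> ->; exists 1%N, 0%N; split=> [|v];
  rewrite ?expg0 ?expg1 ?invg1 ?mulg1 ?subr0.
- by move=> _; exists 0%N, 0%N; split=> [|v]; rewrite ?expg0 ?mulgV ?subrr.
- case=> /IH1 [a [b [-> E1]]] /IH2 [c [d [-> E2]]]; exists (a + c)%N, (b + d)%N.
  split=> [|v]; last by rewrite E1 E2 -mulrzDr !PoszD opprD addrACA.
  rewrite [(b + d)%N]addnC !expgnDr invgM !mulgA; congr (_ * _).
  rewrite -!mulgA; congr (_ * _).
  by apply: commute_sym; apply: commuteV; apply: commuteX2.
- move=> /IHT [a [b [-> E]]]; exists b, a.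
  by split=> [|v]; rewrite ?invgF // E -mulrNz opprB.
- case=> /IH1 [a [b [-> E1]]] /IH2 [c [d [-> E2]]]; exists 0%N, 0%N; split=> [|v].
    by rewrite mulgV; apply/eqP/commgP/comm.
  rewrite !E1 !E2 !(zmod_morphismMz _ _ (m_add x)) subrr mulr0z -!mulrzA.
  by rewrite [X in (_ *~ X - _)%R]mulrC subrr.
Qed.

End OneLetter.

Section LazardStep.
Variables (G : groupType) (I : eqType) (wt : I -> nat) (el : I -> G) (x : I).
Hypothesis el_lcs : forall i, lcs G (wt i) (el i).

(* The letter [(k, y)] stands for [[y, x, ..., x]] with [k] occurrences of [x]. *)
Definition step_wt (u : nat * I) := (u.1 * wt x + wt u.2)%N.
Definition step_el (u : nat * I) := iter u.1 (fun g => [~ g, el x]) (el u.2).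
Definition step_over (A : I -> Prop) (u : nat * I) := A u.2 /\ u.2 != x.

Lemma step_el_lcs u : lcs G (step_wt u) (step_el u).
Proof.
case: u => k y; rewrite /step_wt /step_el /=; elim: k => [|k IHk] /=; first exact:
  el_lcs.
by rewrite mulSn -addnA addnC; apply: commg_lcs_lcs.
Qed.

(** Elimination in which [x] is the only surviving letter. Nullity of [T] forces the coefficient of
    [x] to vanish, so that [T] and [T'] have the same class. *)
Lemma lazard_step n (A : I -> Prop) T : letters_in A T -> homogeneous wt n T ->
  null T ->
  exists T', [/\ homogeneous step_wt n T', letters_in (step_over A) T', null T'
    & lcs G n.+1 (eval step_el T') -> lcs G n.+1 (eval el T)].
Proof.
move=> overT homT nullT.
pose phi (_ : I) (u : nat * I) := Some (u.1.+1, u.2).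
have [|h u /eqP -> _ [A'u ux] /=|T' [homT' overT' symT actT]] :=
  eliminate (H := pred1 x) (beta := fun y => (0%N, y)) (phi := phi)
    (A' := step_over A) el_lcs step_el_lcs _ _ overT homT.
- by move=> y /= yx Ay; split.
- by split=> //; rewrite /step_wt /=; lia.
have addD i : zmod_morphism (word_deriv (phi i)) by apply: word_deriv_additive.
set tau := fun i => if _ then _ else _ in actT.
have addtau i : zmod_morphism (tau i) by rewrite /tau; case: ifP.
have overK : letters_in (fun i => i = x) (kill (pred1 x) T).
  by apply: letters_in_sub (letters_in_kill (pred1 x) overT) => i [/eqP].
have [a [b [evalK actK]]] := one_letter el addD overK.
(* Derivations vanish at the empty word, so only [T'] contributes there. *)
have nullT' : null T'.
  move=> f; have := congr1 (@^~ [::]) (actT f).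
  by rewrite (null_act _ addtau nullT) actK !fctE fct_mulrz mul0rz add0r.
exists T'; split=> // evalT'; apply/(symbol_eq0 el_lcs homT).
rewrite symT; have /(symbol_eq0 step_el_lcs homT') -> := evalT'.
rewrite addr0 /symbol evalK.
suffices -> : a = b by rewrite mulgV.
(* The derivation maps the letter [(0, x)] to [(1, x)], so this test function isolates the
   coefficient [a - b]. The letter [(0, x)] violates [step_over], but the operators are defined on
   all words. *)
have /(congr1 (@^~ [:: (0%N, x)])) := actT (fun w => Posz (w == [:: (1%N, x)])).
have addL := @lmul_additive (nat * I)%type.
rewrite (null_act _ addtau nullT) (null_act _ addL nullT') actK addr0 fct_mulrz.
rewrite /word_deriv /= /lmul eqxx addr0 intz => /esym/eqP.
by rewrite subr_eq0 => /eqP[].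
Qed.

End LazardStep.

(** No non-trivial monomial has degree below the weight of its letters. In a bracket the left factor
    has degree at most [n < w], so by induction it already lies one term deeper. *)
Lemma heavy_letters (G : groupType) (I : Type) (wt : I -> nat) (el : I -> G) w n T :
  (forall i, lcs G (wt i) (el i)) -> letters_in (fun i => w <= wt i)%N T ->
  homogeneous wt n T -> (n < w)%N -> lcs G n.+1 (eval el T).
Proof.
move=> el_lcs; elim: T n => [i||T1 IH1 T2 IH2|T IHT|T1 IH1 T2 IH2] n /=.
- by move=> wi win nw; lia.
- by move=> *; apply: lcs1.
- by move=> [/IH1 + /IH2 +] [hom1 hom2] nw => /(_ _ hom1 nw) ? /(_ _ hom2 nw);
  apply: lcsM.
- by move=> /IHT + homT nw => /(_ _ homT nw); apply: lcsV.
- move=> [/IH1 + _] [a [b [-> hom1 hom2]]] nw => /(_ _ hom1) G1.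
  rewrite -addSn; apply: commg_lcs_lcs (eval_lcs el_lcs hom2).
  by apply: G1; apply: leq_ltn_trans nw; apply: leq_addr.
Qed.

(* The free Lie ring on [I] embeds into the free associative ring on [I]. *)
Lemma null_lcs (G : groupType) (I : eqType) (wt : I -> nat) (el : I -> G)
    (A : I -> Prop) n T :
  (forall i, lcs G (wt i) (el i)) -> (forall i, A i -> 0 < wt i)%N ->
  (forall d, exists s : seq I, forall i, A i -> wt i <= d -> i \in s)%N ->
  letters_in A T -> homogeneous wt n T -> null T -> lcs G n.+1 (eval el T).
Proof.
have [d] := ubnP (n.+1 - 1); have : (0 < 1)%N by [].
(* Outer induction on [n.+1 - w], where [w] bounds all weights from below; inner induction on a list
   containing the letters of weight [w]. Once that list is empty, [w] can be increased. *)
suffices gen w : (0 < w)%N -> (n.+1 - w < d)%N ->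
    (forall i, lcs G (wt i) (el i)) -> (forall i, A i -> w <= wt i)%N ->
    (forall d, exists s : seq I, forall i, A i -> wt i <= d -> i \in s)%N ->
    letters_in A T -> homogeneous wt n T -> null T -> lcs G n.+1 (eval el T).
  exact: gen.
elim: d => // d IHd in I wt el A T w *.
move=> w_gt0 le_d; have [n_lt_w|w_le_n] := ltnP n w.
  move=> el_lcs wA _ AT homT _; apply: heavy_letters homT n_lt_w => //.
  exact: letters_in_sub AT.
move=> el_lcs wA finA; have [s1] := finA w.
have [k] := ubnP (size s1).
elim: k => // k IHk in I wt el A T s1 el_lcs wA finA *.
case: s1 => [_ |x s1] /= => [noA|size_s1 inA] AT homT nullT.
  apply: (IHd I wt el A T w.+1) => //; first by lia.
  move=> i Ai; rewrite ltn_neqAle wA // andbT; apply/eqP=> wi.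
  by have := noA _ Ai; rewrite -wi => /(_ (leqnn _)).
(* The list may contain letters that are not admissible or not of weight [w]; these are simply
   dropped. *)
have [[Ax wx]|notAx] := pselect (A x /\ wt x = w); last first.
  apply: (IHk I wt el A T s1) => // i Ai wi.
  have := inA i Ai wi; rewrite inE => /orP[/eqP ix|//].
  by case: notAx; rewrite -ix; split=> //; apply/eqP; rewrite eqn_leq wi wA.
have [T' [homT' AT' nullT']] := lazard_step x el_lcs AT homT nullT.
apply; apply: (IHk _ _ _ _ _ [seq (0%N, y) | y <- s1]) AT' homT' nullT' => //.
- exact: step_el_lcs.
- by case=> j y [/= Ay _]; rewrite /step_wt /=; apply:
  leq_trans (wA _ Ay) (leq_addl _ _).
(* Since [x] weighs [w > 0], a new letter [(j, y)] of weight at most [e] has [j <= e] and [y] among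
   finitely many letters. *)
- move=> e; have [s Hs] := finA e.
  exists [seq (j, y) | j <- iota 0 e.+1, y <- s] => -[j y] [Ay _].
  rewrite /step_wt wx => je; have {}je : (j * w + wt y <= e)%N := je.
  apply/allpairsP; exists (j, y); split=> //; last by apply: (Hs y) => //; apply:
    leq_trans (leq_addl _ _) je.
  by rewrite mem_iota add0n /= ltnS; have := wA _ Ay; move: je w_gt0; nia.
- by rewrite size_map.
(* Both [x] and [y] weigh at least [w > 0], so weight at most [w] forces [j = 0]. Thus [x] leaves
   the list and no letter joins it. *)
- case=> j y [/= Ay yx]; rewrite /step_wt /= wx => jw.
  have wy := wA _ Ay; have j0 : j = 0%N by nia.
  rewrite j0; apply/map_f; have := inA y Ay.
  by rewrite inE (negPf yx); apply; nia.
Qed.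

(** * Partially commutative Lie rings *)

(** Derivations are determined by their values on letters: by the Leibniz rule the mixed terms agree
    and induction on the word handles the rest. *)
Lemma word_derivC (J : Type) (phi psi : J -> option J) f :
  (forall a, obind phi (psi a) = obind psi (phi a)) ->
  word_deriv phi (word_deriv psi f) = word_deriv psi (word_deriv phi f).
Proof.
move=> phi_psi.
have lmulD chi a g : lmul a (word_deriv chi g) =
    (word_deriv chi (lmul a g) + if chi a is Some b then lmul b g else 0)%R.
  by rewrite -(lmul_word_deriv chi a g) addrC subrK.
have derivD chi := zmod_morphismD (word_deriv_additive chi).
have derivE chi g a w : word_deriv chi g (a :: w) =
    ((if chi a is Some b then g (b :: w) else 0) + word_deriv chi (lmul a g) w)%R.
  by [].
apply/funext=> w; elim: w f => [|a w IHw] f //.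
rewrite !derivE !lmulD !derivD !fctE -IHw.
have := phi_psi a.
case: (phi a) => [b|]; case: (psi a) => [c|] /= E; rewrite ?derivE ?E -?E.
- ring.
- by rewrite (zmod_morphism0 (word_deriv_additive _)) !add0r addr0 addrC.
- by rewrite (zmod_morphism0 (word_deriv_additive _)) !add0r addr0 addrC.
- by rewrite !(zmod_morphism0 (word_deriv_additive _)).
Qed.

Section TraceElimination.
Variables (V : choiceType) (adj : rel V) (v : V).
Hypothesis adjC : symmetric adj.
Implicit Types m : seq V.

(** Equality in the partially commutative (Cartier-Foata) monoid on [V]. *)
Inductive trace_eq : seq V -> seq V -> Prop :=
| trace_eq_refl m : trace_eq m m
| trace_eq_sym m m' : trace_eq m m' -> trace_eq m' m
| trace_eq_trans m m' m'' : trace_eq m m' -> trace_eq m' m'' -> trace_eq m m''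
| trace_eq_cons a m m' : trace_eq m m' -> trace_eq (a :: m) (a :: m')
| trace_eq_swap a b m : adj a b -> trace_eq (a :: b :: m) (b :: a :: m).

(** A chosen representative, so that equal traces become equal letters without forming a quotient
    type. *)
Definition canon m := choose (fun m' => `[< trace_eq m m' >]) m.

Lemma trace_eq_canon m : trace_eq m (canon m).
Proof.
apply/asboolP; apply: (@chooseP _ (fun m' => `[< trace_eq m m' >]) m).
exact/asboolP/trace_eq_refl.
Qed.

Lemma canon_eq m m' : trace_eq m m' -> canon m = canon m'.
Proof.
move=> mm'; rewrite /canon.
have -> : (fun m'' => `[< trace_eq m m'' >]) = (fun m'' => `[< trace_eq m' m'' >]).
  apply/funext=> m''; apply/asbool_equiv_eq; split; apply: trace_eq_trans => //.
  exact: trace_eq_sym.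
by apply: choose_id; apply/asboolP; [apply: trace_eq_sym | apply: trace_eq_refl].
Qed.

(* The traces [m] such that ad(m) v = 0 because the first letter to be bracketed
   with [v] can be chosen in the link of [v]. *)
Definition killed m := exists m' h, trace_eq m (rcons m' h) /\ adj h v.

Lemma killed_eq m m' : trace_eq m m' -> killed m -> killed m'.
Proof.
move=> mm' [n [h [mn hv]]]; exists n, h; split=> //.
exact: trace_eq_trans (trace_eq_sym mm') mn.
Qed.

Lemma killed_cons a m : killed m -> killed (a :: m).
Proof.
by move=> [n [h [mn hv]]]; exists (a :: n), h; split=> //; apply: trace_eq_cons.
Qed.

Definition ext h m :=
  if `[< killed (h :: m) >] then None else Some (canon (h :: m)).

Lemma ext_bind a b m : obind (ext a) (ext b m) =
  if `[< killed (a :: b :: m) >] then None else Some (canon (a :: b :: m)).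
Proof.
rewrite {2}/ext; have bm := trace_eq_canon (b :: m).
case: asboolP => [kb|_] /=; first by rewrite asboolT //; apply: killed_cons.
have E : trace_eq (a :: canon (b :: m)) (a :: b :: m).
  exact/trace_eq_cons/trace_eq_sym.
rewrite /ext (canon_eq E); congr (if _ then _ else _).
by apply/asbool_equiv_eq; split; apply: killed_eq => //; apply: trace_eq_sym.
Qed.

Lemma ext_comm a b m : adj a b -> obind (ext a) (ext b m) = obind (ext b) (ext a m).
Proof.
move=> ab; have E := trace_eq_swap m ab.
rewrite !ext_bind (canon_eq E); congr (if _ then _ else _).
by apply/asbool_equiv_eq; split; apply: killed_eq => //; apply: trace_eq_sym.
Qed.

Lemma ext_nil h : adj h v -> ext h [::] = None.
Proof.
by move=> hv; rewrite /ext asboolT //; exists [::], h; split=> //; apply: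
  trace_eq_refl.
Qed.

Definition trace_op i : (seq (seq V) -> int) -> seq (seq V) -> int :=
  if predC1 v i then word_deriv (ext i) else lmul [::].

Lemma trace_op_additive i : zmod_morphism (trace_op i).
Proof. by rewrite /trace_op; case: ifP => _; [apply: word_deriv_additive | apply:
  lmul_additive]. Qed.

(** Two derivations commute because both orders of extension give the same trace. The operator of
    [v] commutes with the derivation of a neighbour because that derivation kills the letter [[::]],
    which stands for [v]. *)
Lemma trace_opC a b f : adj a b -> trace_op a (trace_op b f) = trace_op b (trace_op
  a f).
Proof.
have lmul_nil c g : adj c v ->
    lmul [::] (word_deriv (ext c) g) = word_deriv (ext c) (lmul [::] g).
  by move=> cv; apply/eqP; rewrite -subr_eq0 lmul_word_deriv ext_nil.
move=> ab; rewrite /trace_op /=; have [av|_] := eqVneq a v; have [bv|_] :=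
  eqVneq b v => //=.
- by rewrite lmul_nil // -av adjC.
- by rewrite lmul_nil // -bv.
- by apply: word_derivC => m; rewrite ext_comm // adjC.
Qed.

Section Symbols.
Variables (G : groupType) (el : V -> G).
Hypothesis el_comm : forall a b, adj a b -> commute (el a) (el b).

Definition trace_el m := foldr (fun h g => [~ g, el h]) (el v) m.
Definition trace_wt m := (size m).+1.

Lemma trace_el_lcs m : lcs G (trace_wt m) (trace_el m).
Proof. by elim: m => [|h m IHm] //=; apply: commg_lcs. Qed.

(** For a swap, Jacobi makes the two iterated brackets differ by a bracket with [[~ el b, el a] =
    1]. Equality holds only modulo the next term. *)
Lemma trace_eq_el m m' : trace_eq m m' -> size m = size m' /\
  grc (trace_wt m) (trace_el m) = grc (trace_wt m) (trace_el m').
Proof.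
elim=> {m m'} [m|m m' _ [s e]|m m' m'' _ [s e] _ [s' e']|a m m' _ [s e]|a b m ab].
- by [].
- by split=> //; rewrite /trace_wt -s -e.
- by split; [rewrite s | rewrite e; move: e'; rewrite /trace_wt s].
- rewrite /= s; split=> //; have s1 : trace_wt m = trace_wt m' by rewrite /trace_wt
  s.
  have Gm' := trace_el_lcs m'; rewrite -s1 in Gm'.
  by apply: (@grc_comm_eq _ (trace_wt m) 1) => //;
    [rewrite /trace_wt /= addn1 | apply: trace_el_lcs].
- split=> //=; have Gm := trace_el_lcs m.
  have kE : trace_wt [:: a, b & m] = (trace_wt m + 1 + 1)%N by rewrite /trace_wt
    /=; lia.
  have Ga : lcs G 1 (el a) by []. have Gb : lcs G 1 (el b) by [].
  have /commgP/eqP ba := commute_sym (el_comm ab).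
  have := grc_Jacobi kE Gm Gb Ga; rewrite ba commg1 => /esym/eqP.
  by rewrite subr_eq0 => /eqP.
Qed.

Lemma trace_el_killed m : killed m -> grc (trace_wt m) (trace_el m) = 0%R.
Proof.
case=> m' [h [/trace_eq_el[s ->] hv]]; rewrite /trace_el foldr_rcons.
have /commgP/eqP -> := commute_sym (el_comm hv).
suffices -> : foldr (fun h g => [~ g, el h]) 1 m' = 1 by [].
by elim: m' {s} => //= a m' ->; rewrite comm1g.
Qed.

Lemma ext_el h m :
  if ext h m is Some m' then
    [/\ True, trace_wt m' = (trace_wt m + 1)%N
      & grc (trace_wt m') (trace_el m') = grc (trace_wt m') [~ trace_el m, el h]]
  else grc (trace_wt m + 1) [~ trace_el m, el h] = 0%R.
Proof.
rewrite /ext; case: asboolP => [/trace_el_killed|_]; first by rewrite addn1.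
have [s e] := trace_eq_el (trace_eq_canon (h :: m)).
have wE : trace_wt (canon (h :: m)) = trace_wt (h :: m) by rewrite /trace_wt s.
by rewrite wE e; split=> //; rewrite addn1.
Qed.

End Symbols.
End TraceElimination.

Lemma finite_words (V : finType) d :
  exists s : seq (seq V), forall m, (size m < d)%N -> m \in s.
Proof.
elim: d => [|d [s Hs]]; first by exists [::].
exists ([::] :: [seq a :: m | a <- enum V, m <- s]) => -[|a m] //= /Hs ms.
rewrite inE; apply/allpairsP; exists (a, m); split=> //.
by rewrite mem_enum.
Qed.

Section CommutingReps.
Variables (V : finType) (adj : rel V).
Hypothesis adjC : symmetric adj.

(** Vanishing in the associative ring with commuting adjacent generators, tested through
    representations on integer-valued functions, the kind on which the word operators act. *)
Definition adj_null (T : lie_term V) : Prop :=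
  forall (J : Type) (m : V -> (J -> int) -> (J -> int)),
    (forall i, zmod_morphism (m i)) ->
    (forall a b f, adj a b -> m a (m b f) = m b (m a f)) ->
    forall f, act m T f = 0%R.

(* The Lie ring generated by [V], where adjacent generators commute, embeds into
   the corresponding associative ring. *)
Lemma adj_null_lcs (G : groupType) (el : V -> G) (s : seq V) n T :
  (forall a b, adj a b -> commute (el a) (el b)) ->
  letters_in (fun i => i \in s) T -> homogeneous (fun=> 1%N) n T -> adj_null T ->
  lcs G n.+1 (eval el T).
Proof.
move=> el_comm; elim: s T => [|v s IHs] T sT homT nullT.
  apply: (@heavy_letters _ _ (fun=> 1%N) el n.+1) => //.
  exact: letters_in_sub sT.
have el_lcs i : lcs G 1 (el i) by [].
have [|h u _ _ _|T' [homT' letT' symT actT]] :=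
  @eliminate G V (seq V) (fun=> 1%N) el (@trace_wt V) (trace_el v el) (predC1 v)
    (fun i => i \in v :: s) (fun=> True) (fun=>
      [::]) (ext adj v) el_lcs (trace_el_lcs v el) _ _ n T sT homT.
- by move=> y /= /negbNE/eqP -> _.
- exact: ext_el.
rewrite -/(trace_op adj v) in actT.
have add_op := trace_op_additive adj v.
have opC a b f : adj a b -> trace_op adj v a (trace_op adj v b f) = trace_op adj v
  b (trace_op adj v a f).
  exact: trace_opC.
(* A derivation vanishes at the empty word, so the operator identity evaluated there sees only
   [T']. *)
have D_nil K f : act (fun i => word_deriv (ext adj v i)) K f [::] = 0%R.
  elim: K f => [i||T1 IH1 T2 IH2|K IHK|T1 IH1 T2 IH2] f //=.
  - by rewrite fctE IH1 IH2.
  - by rewrite fctE IHK.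
  - by rewrite fctE opprfctE IH1 IH2.
have nullT' : null T'.
  move=> f; have /(congr1 (@^~ [::])) := actT f.
  by rewrite (nullT _ _ add_op opC) fctE D_nil add0r.
(* The ideal generated by [v] is compared with the free Lie ring on traces, which has finitely many
   letters in each weight. *)
have GT' : lcs G n.+1 (eval (trace_el v el) T').
  apply: (null_lcs (trace_el_lcs v el)) letT' homT' nullT' => // d.
  by have [words Hwords] := finite_words V d; exists words => m _; apply: Hwords.
apply/(symbol_eq0 el_lcs homT); rewrite symT.
have /(symbol_eq0 (trace_el_lcs v el) homT') -> := GT'.
rewrite addr0; have homK := homogeneous_kill (predC1 v) homT.
apply/(symbol_eq0 el_lcs homK); apply: IHs => //.
  apply: letters_in_sub (letters_in_kill (predC1 v) sT) => i [/= iv].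
  by rewrite inE (negPf iv).
(* A representation of the remaining vertices extends by letting [v] act as zero, which respects all
   commutations; hence nullity passes to the surviving part. *)
move=> J m m_add mC f; pose m' i := if i == v then fun=> 0%R else m i.
have m'_add i : zmod_morphism (m' i).
  by rewrite /m'; case: ifP => _ //; move=> g h; rewrite subr0.
rewrite -(@eq_act _ _ m' m (fun i => predC1 v i /\ i \in v :: s)); last 2 first.
- by move=> i [/= /negPf iv _]; rewrite /m' iv.
- exact: letters_in_kill.
rewrite act_kill; last by move=> i /= /negbNE iv; rewrite /m' iv.
apply: nullT => // a b g ab; rewrite /m'.
by case: eqP => _; case: eqP => _ //; rewrite ?(zmod_morphism0 (m_add _)) // mC.
Qed.

End CommutingReps.

(** * The lower central series of a RAAG is isolated *)

Section PresentedAction.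
Variables (X : choiceType) (R : seq (X * bool) -> seq (X * bool) -> Prop).
Variables (A : Type) (op : X * bool -> A -> A).

Definition word_op w x := foldr op x w.

Hypothesis op_cancel : forall a x, op a (op (inv_letter a) x) = x.
Hypothesis op_rel : forall u v x, R u v -> word_op u x = word_op v x.

Lemma word_op_eq u v : word_eq R u v -> word_op u = word_op v.
Proof.
have catE w w' x : word_op (w ++ w') x = word_op w (word_op w' x) by apply:
  foldr_cat.
elim=> {u v} [u v uv|a|u u' v v' _ uu' _ vv'|u|u v _ uv|v u w _ uv _ vw] //.
- by apply/funext=> x; apply: op_rel.
- by apply/funext=> x; apply: op_cancel.
- by apply/funext=> x; rewrite !catE uu' vv'.
- by rewrite uv.
Qed.

Definition group_op (g : presented_group R) : A -> A := word_op (repr g).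

Lemma group_op_class w : group_op (word_class R w) = word_op w.
Proof. exact/word_op_eq/repr_word_class. Qed.

Lemma group_op1 x : group_op 1 x = x.
Proof. by rewrite [1]/(word_class R [::]) group_op_class. Qed.

Lemma group_opM g h x : group_op (g * h) x = group_op g (group_op h x).
Proof.
rewrite -{1}(word_classK g) -{1}(word_classK h).
rewrite -[_ * _]/(presented_mul _ _) -word_class_cat group_op_class.
exact: foldr_cat.
Qed.

End PresentedAction.

Section AdditiveAction.
Variables (G : groupType) (M : zmodType) (rho : G -> M -> M).
Hypothesis rho1 : forall v, rho 1 v = v.
Hypothesis rhoM : forall g h v, rho (g * h) v = rho g (rho h v).
Hypothesis rho_add : forall g, zmod_morphism (rho g).

Lemma actM_sub g h v : (rho (g * h) v - v = rho g (rho h v - v) + (rho g v - v))%R.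
Proof. by rewrite rhoM rho_add addrA subrK. Qed.

Lemma actV_sub g v : (rho g^-1 v - v = - rho g^-1 (rho g v - v))%R.
Proof. by rewrite rho_add -rhoM mulVg rho1 opprB. Qed.

(** Group ring identity for [[~ g, h] - 1] in terms of the ring commutator of [g - 1] and [h - 1].
    It serves both the filtration by powers of t and the p-adic one. *)
Lemma actR_sub g h v : (rho [~ g, h] v - v = rho (g^-1 * h^-1)
  ((rho g (rho h v - v) - (rho h v - v)) - (rho h (rho g v - v) - (rho g v -
    v))))%R.
Proof.
have swap (p q r s u : M) : (p - q - (r - u) - (s - r - (q - u)) = p - s)%R.
  rewrite -[(p - q - _)%R]addrA -opprD -[(s - r - _)%R]addrA -opprD.
  by rewrite [(q + (r - u))%R]addrCA; move: (r + _)%R => w;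
    rewrite opprB addrA subrK.
rewrite (rho_add g) (rho_add h) swap (rho_add (g^-1 * h^-1)) -!rhoM;
  congr (_ - _)%R.
  by rewrite /commg /conjg !gnorm.
by rewrite !gnorm rho1.
Qed.

End AdditiveAction.

Section Raag.
Variables (V : finType) (E : {set {set V}}).
Local Notation A := (raag E).

Definition adj : rel V := fun u v => [set u; v]%SET \in E.

Lemma adjC : symmetric adj.
Proof. by move=> u v; rewrite /adj finset.setUC. Qed.

Definition gen v : A := word_class (raag_rel E) [:: (v, true)].

Lemma genV v : (gen v)^-1 = word_class (raag_rel E) [:: (v, false)].
Proof. by rewrite -[LHS]/(presented_inv _) -word_class_inv. Qed.

Lemma word_class_cons a w : word_class (raag_rel E) (a :: w) =
  ((if a.2 then gen a.1 else (gen a.1)^-1) : A) * (word_class (raag_rel E) w : A).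
Proof.
rewrite -cat1s word_class_cat; case: a => v [] //=.
by rewrite genV.
Qed.

Lemma gen_comm u v : adj u v -> commute (gen u) (gen v).
Proof.
move=> uv; rewrite /commute -![gen _ * gen _]/(presented_mul _ _).
rewrite -!word_class_cat; apply/word_classP/word_eq_rel.
by exists u, v.
Qed.

Lemma gen_ind (P : A -> Prop) : P 1 -> (forall v g, P g -> P (gen v * g)) ->
  (forall v g, P g -> P ((gen v)^-1 * g)) -> forall g, P g.
Proof.
move=> P1 PM PV g; rewrite -(word_classK g).
elim: (repr g) => [|[v b] w IHw] //.
by rewrite word_class_cons; case: b => /=; [apply: PM | apply: PV].
Qed.

Lemma lcs1_term g : exists T, homogeneous (fun=> 1%N) 1 T /\ eval gen T = g.
Proof.
elim/gen_ind: g => [|v g [T [homT <-]]|v g [T [homT <-]]]; first by exists Zero.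
  by exists (Add (Gen v) T).
by exists (Add (Opp (Gen v)) T).
Qed.

(** Each graded piece is spanned by iterated brackets of generators. The induction carries
    membership in the lower central series as well, since classes add only there. *)
Lemma lcs_term n g : lcs A n.+1 g ->
  exists T, homogeneous (fun=> 1%N) n.+1 T /\ grc n.+1 g = symbol gen n.+1 T.
Proof.
have gen_lcs v : lcs A 1 (gen v) by [].
elim: n g => [|n IHn] g.
  by have [T [homT <-]] := lcs1_term g; exists T.
move=> Gg; have : (lcs A n.+2 `&` [set g | exists T, homogeneous (fun=>
  1%N) n.+2 T /\
    grc n.+2 g = symbol gen n.+2 T])%classic g; last by case.
apply: Gg => {g}; split.
  split=> [|x y [Gx [S [homS eS]]] [Gy [T [homT eT]]]|x [Gx [T [homT eT]]]].
  - by split; [apply: lcs1 | exists Zero].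
  - split; first exact: lcsM.
    by exists (Add S T); split=> //; rewrite (symbolD gen_lcs) // grcM // eS eT.
  - split; first exact: lcsV.
    by exists (Opp T); split=> //; rewrite (symbolN gen_lcs) // grcV // eT.
move=> _ [x Gx [y _ <-]]; split; first exact: commg_lcs.
have [S [homS eS]] := IHn x Gx; have [T [homT eT]] := lcs1_term y.
exists (Br S T); split; first by exists n.+1, 1%N; rewrite addn1.
rewrite -eT; apply: (grc_comm_eq (m := n.+1) (n := 1%N)) => //;
  first by rewrite addn1.
exact: (eval_lcs gen_lcs).
Qed.

(* A representation of the commutation relations on [M] by operators [m v]
   makes [v] act on the power series [M[[t]]] as [1 + t * m v]. *)
Section SeriesAction.
Variables (M : zmodType) (m : V -> M -> M).
Hypothesis m_add : forall i, zmod_morphism (m i).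
Hypothesis mC : forall a b f, adj a b -> m a (m b f) = m b (m a f).
Implicit Types F : nat -> M.

Definition series_mul v F : nat -> M :=
  fun j => (F j + if j is j'.+1 then m v (F j') else 0)%R.

Fixpoint series_div_at v F j : M :=
  (F j - if j is j'.+1 then m v (series_div_at v F j') else 0)%R.

Definition series_op (a : V * bool) F : nat -> M :=
  if a.2 then series_mul a.1 F else series_div_at a.1 F.

Lemma series_op_cancel a F : series_op a (series_op (inv_letter a) F) = F.
Proof.
case: a => v []; apply/funext; rewrite /series_op /=.
  by case=> [|j]; rewrite /series_mul /= ?subr0 ?addr0 ?subrK.
elim=> [|j IHj] /=; first by rewrite /series_mul addr0 subr0.
by rewrite IHj /series_mul addrK.
Qed.

Lemma series_op_rel u v F : raag_rel E u v ->
  word_op series_op u F = word_op series_op v F.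
Proof.
case=> a [b [ab -> ->]]; apply/funext=> -[|[|j]]; rewrite /series_op /= /series_mul.
- by [].
- by rewrite !addr0 addrAC.
- have mD c := zmod_morphismD (m_add c).
  by rewrite !mD (mC _ ab) !addrA; congr (_ + _)%R; rewrite addrAC.
Qed.

Definition series_act (g : A) : (nat -> M) -> nat -> M := group_op series_op g.

Lemma series_act1 F : series_act 1 F = F.
Proof. by apply: group_op1; [apply: series_op_cancel | apply: series_op_rel]. Qed.

Lemma series_actM g h F : series_act (g * h) F = series_act g (series_act h F).
Proof. by apply: group_opM; [apply: series_op_cancel | apply: series_op_rel]. Qed.

Lemma series_act_gen v : series_act (gen v) = series_mul v.
Proof. by apply: group_op_class; [apply: series_op_cancel | apply:
  series_op_rel]. Qed.

Lemma series_act_genV v F : series_act (gen v)^-1 F = series_div_at v F.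
Proof.
by rewrite genV /series_act group_op_class;
  [|apply: series_op_cancel | apply: series_op_rel].
Qed.

Lemma series_mul_additive v : zmod_morphism (series_mul v).
Proof.
move=> F F'; apply/funext=> j; rewrite /series_mul !fctE opprD addrACA.
by congr (_ + _)%R; case: j => [|j]; rewrite ?subr0 // -m_add.
Qed.

Lemma series_act_additive g : zmod_morphism (series_act g).
Proof.
elim/gen_ind: g => [|v g IHg|v g IHg] F F'.
- by rewrite !series_act1.
- by rewrite !series_actM IHg series_act_gen series_mul_additive.
- rewrite !series_actM IHg !series_act_genV; apply/funext=> j.
  elim: j => [|j IHj] /=; first by rewrite !fctE /= !subr0.
  rewrite IHj !fctE m_add /= !opprB addrACA [RHS]addrACA; congr (_ + _)%R; exact:
    addrC.
Qed.

Definition vanishes d F := forall j, (j < d)%N -> F j = 0%R.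

(** Every group element acts as the identity modulo t, hence fixes the lowest possible
    coefficient. *)
Lemma series_act_low g d F j : vanishes d F -> (j <= d)%N -> series_act g F j = F j.
Proof.
move=> Fd; elim/gen_ind: g j => [|v g IHg|v g IHg] j jd.
- by rewrite series_act1.
- rewrite series_actM series_act_gen /series_mul IHg //.
  case: j jd => [|j] jd; rewrite ?addr0 // IHg 1?ltnW // (Fd j) //.
  by rewrite (zmod_morphism0 (m_add v)) addr0.
- rewrite series_actM series_act_genV.
  elim: j jd => [|j IHj] jd /=; first by rewrite subr0 IHg.
  by rewrite IHj 1?ltnW // (Fd j) // (zmod_morphism0 (m_add v)) subr0 IHg.
Qed.

(** Says that [g] acts as 1 + t^n P plus higher powers of t, that is, [P] is the term of degree [n]
    in its Magnus expansion. *)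
Definition leading n (g : A) (P : M -> M) := forall d F, vanishes d F ->
  vanishes (d + n) (series_act g F - F)%R /\
  ((series_act g F - F) (d + n)%N = P (F d))%R.

Lemma leading1 n : leading n 1 (fun=> 0%R).
Proof. by move=> d F _; rewrite series_act1 subrr. Qed.

Lemma leading_gen v : leading 1 (gen v) (m v).
Proof.
move=> d F Fd; rewrite series_act_gen /series_mul addn1.
split=> [j jd|]; rewrite !fctE addrC addKr //.
by case: j jd => // j jd; rewrite Fd // (zmod_morphism0 (m_add v)).
Qed.

Lemma leadingM n g h P Q : leading n g P -> leading n h Q ->
  leading n (g * h) (fun v => P v + Q v)%R.
Proof.
move=> gP hQ d F Fd; have [g0 gv] := gP d F Fd; have [h0 hv] := hQ d F Fd.
have actE := actM_sub series_actM series_act_additive g h F.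
have low j : (j <= d + n)%N -> ((series_act (g * h) F - F) j =
    (series_act h F - F) j + (series_act g F - F) j)%R.
  by move=> jn; rewrite actE; congr (_ + _)%R; apply: series_act_low jn.
split=> [j jn|]; first by rewrite low 1?ltnW // g0 // h0 // addr0.
by rewrite low // gv hv addrC.
Qed.

Lemma leadingV n g P : leading n g P -> leading n g^-1 (fun v => - P v)%R.
Proof.
move=> gP d F Fd; have [g0 gv] := gP d F Fd.
have actE := actV_sub series_act1 series_actM series_act_additive g F.
have low j : (j <= d + n)%N ->
    ((series_act g^-1 F - F) j = - (series_act g F - F) j)%R.
  by move=> jn; rewrite actE; congr (- _)%R; apply: series_act_low jn.
split=> [j jn|]; first by rewrite low 1?ltnW // g0 // oppr0.
by rewrite low // gv.
Qed.

Lemma leadingR a b g h P Q : leading a g P -> leading b h Q ->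
  leading (a + b) [~ g, h] (fun v => P (Q v) - Q (P v))%R.
Proof.
move=> gP hQ d F Fd; have [g0 gv] := gP d F Fd; have [h0 hv] := hQ d F Fd.
have [gh0 ghv] := gP _ _ h0; have [hg0 hgv] := hQ _ _ g0.
have actE := actR_sub series_act1 series_actM series_act_additive g h F.
set X := (series_act g _ - _)%R in gh0 ghv actE.
set Y := (series_act h _ - _)%R in hg0 hgv actE.
have XY0 : vanishes (d + (a + b)) (X - Y)%R.
  by move=> j jab; rewrite !fctE gh0 ?hg0 ?subr0 //; lia.
have low j : (j <= d + (a + b))%N -> ((series_act [~ g, h] F - F) j = X j - Y j)%R.
  by move=> jab; rewrite actE (series_act_low _ XY0).
split=> [j jab|]; first by rewrite low 1?ltnW // gh0 ?hg0 ?subr0 //; lia.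
rewrite low //; congr (_ - _)%R.
  by rewrite [(a + b)%N]addnC addnA ghv hv.
by rewrite addnA hgv gv.
Qed.

(** Group commutators have ring commutators as leading terms, so the two readings of a Lie term
    agree in lowest degree. *)
Lemma leading_eval n T : homogeneous (fun=> 1%N) n T ->
  leading n (eval gen T) (act m T).
Proof.
elim: T n => [i||T1 IH1 T2 IH2|T IHT|T1 IH1 T2 IH2] n /=.
- by move<-; apply: leading_gen.
- by move=> _; apply: leading1.
- by case=> /IH1 ? /IH2; apply: leadingM.
- by move/IHT; apply: leadingV.
- by case=> a [b [-> /IH1 ? /IH2 ?]]; apply: leadingR.
Qed.

Lemma leading_lcs n g : lcs A n.+1 g -> exists P, leading n.+1 g P.
Proof.
elim: n g => [|n IHn] g.
  by have [T [homT <-]] := lcs1_term g; exists (act m T); apply: leading_eval.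
apply: (@generated_min _ _ [set g | exists P, leading n.+2 g P]%classic) => {g}.
  split=> [|x y [P xP] [Q yQ]|x [P xP]].
  - by eexists; apply: leading1.
  - by eexists; apply: leadingM xP yQ.
  - by eexists; apply: leadingV xP.
move=> _ [x Gx [y _ <-]]; have [P xP] := IHn x Gx.
have [T [homT <-]] := lcs1_term y.
by eexists; rewrite -addn1; apply: leadingR xP (leading_eval homT).
Qed.

End SeriesAction.

(** Replace [g] by a bracket term [T] of the same class. In degree n+1 the k-th power acts by k
    times [T], and this is zero because the power lies deeper. Integer-valued functions have no
    torsion, so [T] vanishes in every representation and [adj_null_lcs] applies. *)
Lemma lcs_isolated_step n k g : (0 < k)%N -> lcs A n.+1 g -> lcs A n.+2 (g ^+ k) ->
  lcs A n.+2 g.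
Proof.
move=> k_gt0 Gg Ggk; have [T [homT gT]] := lcs_term Gg.
have gen_lcs v : lcs A 1 (gen v) by [].
have GT := eval_lcs gen_lcs homT.
apply/(grc_eq0 Gg); rewrite gT; apply/(symbol_eq0 gen_lcs homT).
apply: (adj_null_lcs adjC (s := enum V)) (homT) _ => //.
- exact: gen_comm.
- by apply: letters_in_sub (letters_in_true T) => i _; rewrite mem_enum.
move=> J m m_add mC f.
have : lcs A n.+2 (eval gen T ^+ k).
  apply/grc_eq0; first exact: lcsX.
  by rewrite grcX // -[grc _ _]/(symbol _ _ _) -gT -grcX //; apply/grc_eq0 => //;
    apply: lcsX.
(* The test series is the constant [f], whose image is read at the coefficient n+1. *)
case/(leading_lcs m_add mC) => P /(_ 0%N (fun j =>
  if j is 0 then f else 0)%R) [] // + _.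
move=> /(_ n.+1); rewrite add0n ltnSn => /(_ isT).
have leadX : leading m n.+1 (eval gen T ^+ k) (fun v => act m T v *+ k)%R.
  elim: k {k_gt0 Ggk} => [|k IHk]; first exact: leading1.
  rewrite expgS; have := leadingM m_add mC (leading_eval m_add mC homT) IHk.
  by congr (leading _ _ _ _); apply/funext=> v; rewrite mulrS.
have [] := leadX 0%N (fun j => if j is 0 then f else 0)%R => // _.
rewrite add0n => -> /=; move=> Tk; apply/funext=> j.
have /eqP := congr1 (@^~ j) Tk; rewrite natmulfctE.
by rewrite Num.Theory.mulrn_eq0 eqn0Ngt k_gt0 => /eqP.
Qed.

Lemma rational_lcsE n : (1 <= n)%N -> lcs A n = rational_lcs A n.
Proof.
move=> n_gt0; apply/seteqP; split=> g.
  by move=> Gg; exists (Posz 1).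
case=> k k0 Ggk.
have {k k0 Ggk} [k k_gt0 Ggk] : exists2 k, (0 < k)%N & lcs A n (g ^+ k).
  case: k k0 Ggk => [[|k]|k] //= _ Gk; first by exists k.+1.
  by exists k.+1 => //; rewrite -[g ^+ _]invgK; apply: lcsV.
suffices : forall d, (d < n)%N -> lcs A d.+1 g by move/(_ n.-1);
  rewrite prednK // => /(_ (leqnn _)).
elim=> [|d IHd] dn //; apply: (lcs_isolated_step k_gt0); first by apply: IHd;
  apply: ltnW.
exact: lcs_le dn Ggk.
Qed.

End Raag.

(** * Reduced words *)

Section Deletion.
Variables (V : eqType) (e : rel V).
Hypothesis eC : symmetric e.
Hypothesis eI : irreflexive e.
Implicit Types (v a b : V) (s t : seq V).

(** Left division by [v] in the partially commutative monoid. *)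
Fixpoint del v s : option (seq V) :=
  if s is a :: s' then
    if a == v then Some s' else if e a v then omap (cons a) (del v s') else None
  else None.

(** A letter stands for a whole syllable, so no later copy of a letter may be commuted next to an
    earlier one. *)
Fixpoint reduced s : bool :=
  if s is a :: s' then (del a s' == None) && reduced s' else true.

Lemma size_del v s t : del v s = Some t -> size s = (size t).+1.
Proof.
elim: s t => //= a s IHs t; case: ifP => _; first by case=> ->.
by case: ifP => // _; case: (del v s) IHs => //= t' /(_ _ erefl) -> [<-].
Qed.

Lemma delC a b s : e a b -> obind (del a) (del b s) = obind (del b) (del a s).
Proof.
move=> ab; have ab_neq : a != b by apply: contraTneq ab => ->; rewrite eI.
elim: s => //= c s IHs; have [cb|cb] := eqVneq c b.
  rewrite cb eq_sym (negPf ab_neq) eC ab /=.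
  by case: (del a s) => //= t; rewrite eqxx.
have [ca|ca] := eqVneq c a.
  by rewrite ca ab /=; case: (del b s) => //= t; rewrite eqxx.
case ecb: (e c b); case eca: (e c a) => //=.
- have cons_bind d d' : e c d -> c != d ->
      obind (del d) (omap (cons c) (del d' s)) = omap (cons c) (obind (del d) (del
        d' s)).
    by move=> cd ncd; case: (del d' s) => //= t; rewrite (negPf ncd) cd.
  by rewrite !cons_bind // IHs.
- by case: (del b s) => //= t; rewrite (negPf ca) eca.
- by case: (del a s) => //= t; rewrite (negPf cb) ecb.
Qed.

Lemma reduced_del v s t : reduced s -> del v s = Some t -> reduced t.
Proof.
elim: s t => //= a s IHs t /andP[/eqP as0 rs].
have [_ [<-]//|av] := eqVneq a v; case: ifP => // eav.
case svt: (del v s) => [t'|] //= [<-] /=; rewrite (IHs t') // andbT.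
by have := delC s eav; rewrite svt as0 /= => ->.
Qed.

(** Two copies of [v] that both reach the front could be merged. This makes the deletion operators
    square to zero. *)
Lemma del_del v s : reduced s -> obind (del v) (del v s) = None.
Proof.
elim: s => //= a s IHs /andP[/eqP as0 /IHs {}IHs].
have [<-//|av] := eqVneq a v; case: ifP => // eav.
by move: IHs; case: (del v s) => //= t; rewrite (negPf av) eav => ->.
Qed.

End Deletion.

Section Syllables.
Variables (V : finType) (E : {set {set V}}).
Hypothesis adjI : irreflexive (adj E).
Local Notation A := (raag E).
Local Notation del := (del (adj E)).
Local Notation reduced := (reduced (adj E)).

Lemma zexpgD (G : groupType) (g : G) (a b : int) :
  zexpg g (a + b)%R = zexpg g a * zexpg g b.
Proof.
have sub m n : zexpg g (m%:Z - n%:Z)%R = g ^+ m / g ^+ n.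
  have [nm|mn] := leqP n m.
    by rewrite subzn //= expgnFr.
  rewrite -opprB subzn 1?ltnW // -[g ^+ m / _]invgK invgF -expgnFr 1?ltnW //.
  by have := mn; rewrite -subn_gt0; case: (n - m)%N.
case: a => m; case: b => n; rewrite ?NegzE.
- by rewrite -PoszD /= expgnDr.
- by rewrite sub -NegzE.
- by rewrite addrC sub -NegzE; apply: commuteV; apply: commuteX2.
- rewrite -opprD -PoszD addSn -NegzE /= -invgM -expgnDr.
  by congr (natexp _ _)^-1; lia.
Qed.

Lemma zexpg_comm (G : groupType) (g h : G) a b : commute g h ->
  commute (zexpg g a) (zexpg h b).
Proof.
move=> gh; have X m n : commute (g ^+ m) (h ^+ n) by apply: commuteX2.
case: a b => m [] n //=; [exact: commuteV| |].
  exact/commute_sym/commuteV/commute_sym.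
exact/commuteV/commute_sym/commuteV/commute_sym.
Qed.

Definition syllable_prod (s : seq (V * int)) : A :=
  foldr (fun x g => zexpg (gen E x.1) x.2 * g) 1 s.

Definition nonzero_exps (s : seq (V * int)) := all (fun x => x.2 != 0%R) s.

Lemma syllable_del v s t : del v (unzip1 s) = Some t -> nonzero_exps s ->
  exists k s', [/\ unzip1 s' = t, nonzero_exps s'
    & syllable_prod s = zexpg (gen E v) k * syllable_prod s'].
Proof.
elim: s t => //= -[a k] s IHs t /=; have [-> [<-] /andP[_ s0]|av] := eqVneq a v.
  by exists k, s.
case: ifP => // eav; case svt: (del v (unzip1 s)) => [t'|] //= [<-] /andP[k0 s0].
have [k' [s' [s't' s'0 ->]]] := IHs _ svt s0.
exists k', ((a, k) :: s'); split=> /=; [by rewrite s't' | by rewrite k0 | ].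
by rewrite !mulgA; congr (_ * _); apply/zexpg_comm/gen_comm.
Qed.

Lemma reduced_form g : exists s,
  [/\ reduced (unzip1 s), nonzero_exps s & syllable_prod s = g].
Proof.
have step v k s : k != 0%R -> reduced (unzip1 s) -> nonzero_exps s -> exists s',
    [/\ reduced (unzip1 s'), nonzero_exps s'
      & syllable_prod s' = zexpg (gen E v) k * syllable_prod s].
  move=> k0 rs s0; case svt: (del v (unzip1 s)) => [t|]; last first.
    by exists ((v, k) :: s); split=> //=; rewrite ?svt ?rs ?k0.
  (* The new syllable merges with the one brought to the front. If the exponents cancel, both
     disappear; otherwise [del_del] keeps the word reduced. *)
  have [k' [s' [s't s'0 ->]]] := syllable_del svt s0; rewrite mulgA -zexpgD.
  have rt := reduced_del (adjC E) adjI rs svt.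
  have [->|kk'] := eqVneq (k + k')%R 0%R.
    by exists s'; rewrite s't; split=> //=; rewrite mul1g.
  exists ((v, k + k')%R :: s'); split=> //=; rewrite ?kk' // s't rt andbT.
  by have := del_del v rs; rewrite svt /= => ->.
elim/gen_ind: g => [|v g [s [rs s0 <-]]|v g [s [rs s0 <-]]]; first by exists [::].
  by have [s' [? ? e]] := step v (Posz 1) s isT rs s0; exists s'.
by have [s' [? ? e]] := step v (Negz 0) s isT rs s0; exists s'.
Qed.

End Syllables.

(** * Unipotent representations modulo prime powers *)

Section PartialShifts.
Variables (V : finType) (E : {set {set V}}).
Variables (J : finType) (shift : V -> J -> option J) (rk : J -> nat) (p k : nat).
Hypothesis shiftC : forall a b j, adj E a b ->
  obind (shift a) (shift b j) = obind (shift b) (shift a j).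
Hypothesis shift_shift : forall v j, obind (shift v) (shift v j) = None.
Hypothesis rk_shift : forall v j j', shift v j = Some j' -> rk j = (rk j').+1.
Hypothesis p_gt1 : (1 < p)%N.
Hypothesis k_gt0 : (0 < k)%N.

Local Notation A := (raag E).
Local Notation B := {ffun J -> 'Z_(p ^ k)}.
Implicit Types (f : B) (g h : A).

Definition shift_op v f : B := [ffun j => oapp f 0%R (shift v j)].

Lemma shift_op_additive v : zmod_morphism (shift_op v).
Proof. by move=> f f'; apply/ffunP=> j; rewrite !ffunE; case: (shift v j) =>
  [j'|] /=; rewrite ?ffunE ?subr0. Qed.

Lemma shift_opC a b f : adj E a b -> shift_op a (shift_op b f) = shift_op b
  (shift_op a f).
Proof.
have opE c d (f' : B) j : shift_op c (shift_op d f') j = oapp f' 0%R (obind (shift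
  d) (shift c j)).
  by rewrite ffunE; case: (shift c j) => //= j'; rewrite ffunE.
by move=> ab; apply/ffunP=> j; rewrite !opE shiftC // adjC.
Qed.

Lemma shift_op_shift_op v f : shift_op v (shift_op v f) = 0%R.
Proof.
apply/ffunP=> j; rewrite ffunE; have := shift_shift v j.
by case: (shift v j) => [j'|] /=; rewrite !ffunE // => ->.
Qed.

(* As [shift_op v] has square zero, [1 - shift_op v] is the inverse of
   [1 + shift_op v]. *)
Definition shift_letter (a : V * bool) f : B :=
  (if a.2 then f + shift_op a.1 f else f - shift_op a.1 f)%R.

Lemma shift_letter_cancel a f : shift_letter a (shift_letter (inv_letter a) f) = f.
Proof.
case: a => v []; rewrite /shift_letter /=.
  by rewrite shift_op_additive shift_op_shift_op subr0 subrK.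
by rewrite (zmod_morphismD (shift_op_additive v)) shift_op_shift_op addr0 addrK.
Qed.

Lemma shift_letter_rel u w f : raag_rel E u w ->
  word_op shift_letter u f = word_op shift_letter w f.
Proof.
case=> a [b [ab -> ->]]; rewrite /= /shift_letter /=.
have D c := zmod_morphismD (shift_op_additive c).
by rewrite !D (shift_opC _ ab) -!addrA; congr (_ + _)%R; rewrite addrCA.
Qed.

Definition shift_act g : B -> B := group_op shift_letter g.

Lemma shift_act1 f : shift_act 1 f = f.
Proof. by apply: group_op1; [apply: shift_letter_cancel | apply:
  shift_letter_rel]. Qed.

Lemma shift_actM g h f : shift_act (g * h) f = shift_act g (shift_act h f).
Proof. by apply: group_opM; [apply: shift_letter_cancel | apply:
  shift_letter_rel]. Qed.

Lemma shift_act_gen v f : shift_act (gen E v) f = (f + shift_op v f)%R.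
Proof.
by rewrite /shift_act group_op_class; [|apply: shift_letter_cancel | apply:
  shift_letter_rel].
Qed.

Lemma shift_act_genV v f : shift_act (gen E v)^-1 f = (f - shift_op v f)%R.
Proof.
by rewrite genV /shift_act group_op_class;
  [|apply: shift_letter_cancel | apply: shift_letter_rel].
Qed.

Lemma shift_act_additive g : zmod_morphism (shift_act g).
Proof.
elim/gen_ind: g => [|v g IHg|v g IHg] f f'.
- by rewrite !shift_act1.
- by rewrite !shift_actM IHg !shift_act_gen shift_op_additive opprD addrACA.
- rewrite !shift_actM IHg !shift_act_genV shift_op_additive !opprB.
  by rewrite addrACA [RHS]addrACA; congr (_ + _)%R; rewrite addrC.
Qed.

Lemma shift_act_zexpg v (c : int) f :
  shift_act (zexpg (gen E v) c) f = (f + shift_op v f *~ c)%R.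
Proof.
have opMn n : shift_op v (shift_op v f *+ n)%R = 0%R.
  by rewrite pmulrn (zmod_morphismMz _ _ (shift_op_additive v)) shift_op_shift_op
    mul0rz.
case: c => n /=.
  elim: n => [|n IHn]; first by rewrite shift_act1 addr0.
  rewrite expgS shift_actM IHn shift_act_gen (zmod_morphismD (shift_op_additive v)).
  by rewrite opMn addr0 addrAC -addrA -mulrS.
rewrite NegzE mulrNz -pmulrn -expVgn; elim: n.+1 => [|m IHm];
  first by rewrite shift_act1 subr0.
rewrite expgS shift_actM IHm shift_act_genV (shift_op_additive v).
by rewrite opMn subr0 addrAC -addrA -opprD -mulrS.
Qed.

(* The p-adic filtration, shifted by the rank so that both [p] and the operators
   [shift_op v] raise it. *)
Definition filt s f := forall j, exists c, f j = (c *+ p ^ (s - rk j))%R.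

Lemma filtD s f f' : filt s f -> filt s f' -> filt s (f + f')%R.
Proof.
by move=> fs f's j; have [c fc] := fs j; have [c' fc'] := f's j;
  exists (c + c')%R; rewrite ffunE fc fc' mulrnDl.
Qed.

Lemma filtN s f : filt s f -> filt s (- f)%R.
Proof. by move=> fs j; have [c fc] := fs j; exists (- c)%R;
  rewrite ffunE fc mulNrn. Qed.

Lemma filtB s f f' : filt s f -> filt s f' -> filt s (f - f')%R.
Proof. by move=> fs /filtN; apply: filtD. Qed.

Lemma filt0 s : filt s 0%R.
Proof. by move=> j; exists 0%R; rewrite ffunE mul0rn. Qed.

Lemma filtMn s f n : filt s f -> filt s (f *+ n)%R.
Proof.
by move=> fs; elim: n => [|n IHn]; [apply: filt0 | rewrite mulrS; apply: filtD].
Qed.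

Lemma filt_start f : filt 0 f.
Proof. by move=> j; exists (f j). Qed.

Lemma filt_le s t f : (s <= t)%N -> filt t f -> filt s f.
Proof.
move=> st ft j; have [c fc] := ft j.
exists (c *+ p ^ (t - rk j - (s - rk j)))%R.
by rewrite fc -mulrnA -expnD subnK // leq_sub2r.
Qed.

Lemma filt_p s f : filt s f -> filt s.+1 (f *+ p)%R.
Proof.
move=> fs; have [rs|rs] := leqP s.+1 0; first by [].
move=> j; have [c fc] := fs j; rewrite ffunMnE fc -mulrnA -expnSr.
have [rj|rj] := leqP (rk j) s; first by exists c; rewrite subSn.
(* When [rk j] exceeds [s] the truncated exponent [s.+1 - rk j] is 0, and no divisibility is
   required. *)
by exists (c *+ p ^ (s - rk j).+1)%R; rewrite (eqP (_ :
  s.+1 - rk j == 0)%N) // subn_eq0.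
Qed.

Lemma filt_shift_op v s f : filt s f -> filt s.+1 (shift_op v f).
Proof.
move=> fs j; rewrite ffunE; case vj: (shift v j) => [j'|] /=; last by exists 0%R;
  rewrite mul0rn.
by have [c fc] := fs j'; exists c; rewrite fc (rk_shift vj) subSS.
Qed.

Lemma filt_end r s f : (forall j, rk j <= r)%N -> (k + r <= s)%N -> filt s f ->
  f = 0%R.
Proof.
move=> rk_r ks fs; apply/ffunP=> j; have [c ->] := fs j; rewrite ffunE.
have -> : (s - rk j = k + (s - rk j - k))%N by have := rk_r j; lia.
rewrite expnD mulrnA -[(c *+ p ^ k)%R]mulr_natr pchar_Zp ?mulr0 ?mul0rn //.
by rewrite -(exp1n k) ltn_exp2r.
Qed.

Definition depth t g := forall s f, filt s f -> filt (s + t) (shift_act g f - f)%R.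

Lemma filt_act g s f : filt s f -> filt s (shift_act g f).
Proof.
have X v f' : filt s f' -> filt s (shift_op v f').
  by move=> /(filt_shift_op v); apply: filt_le.
elim/gen_ind: g => [|v g IHg|v g IHg] fs; first by rewrite shift_act1.
  by rewrite shift_actM shift_act_gen; apply: filtD; [|apply: X]; apply: IHg.
by rewrite shift_actM shift_act_genV; apply: filtB; [|apply: X]; apply: IHg.
Qed.

Lemma depth_subgroup t : is_subgroup (depth t).
Proof.
split=> [|g h gt ht|g gt] s f fs.
- by rewrite shift_act1 subrr; apply: filt0.
- rewrite (actM_sub shift_actM shift_act_additive); apply: filtD; last exact: gt.
  by apply/filt_act/ht.
- rewrite (actV_sub shift_act1 shift_actM shift_act_additive).
  by apply/filtN/filt_act/gt.
Qed.

Lemma depth1 g : depth 1 g.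
Proof.
elim/gen_ind: g => [|v g IHg|v g IHg] s f fs.
- by have [] := depth_subgroup 1 => + _ _; apply.
- rewrite shift_actM shift_act_gen addrAC addn1; apply: filtD;
  first by rewrite -addn1; apply: IHg.
  exact/filt_shift_op/filt_act.
- rewrite shift_actM shift_act_genV addrAC addn1; apply: filtB;
  first by rewrite -addn1; apply: IHg.
  exact/filt_shift_op/filt_act.
Qed.

Lemma depthR t g h : depth t g -> depth t.+1 [~ g, h].
Proof.
move=> gt s f fs; have hd := depth1 h.
rewrite (actR_sub shift_act1 shift_actM shift_act_additive).
apply: filt_act; apply: filtB.
  by rewrite addnS -addSn -addn1; apply: gt; apply: hd.
by rewrite addnS -addn1; apply: hd; apply: gt.
Qed.

(** The power g^n acts as 1 + n (g - 1) up to terms involving g - 1 twice, which raise the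
    filtration by at least 2t, hence by t+1 as t > 0. For n = p the linear term gains one step from
    the factor p. *)
Lemma depthX t g : (0 < t)%N -> depth t g -> depth t.+1 (g ^+ p).
Proof.
move=> t_gt0 gt s f fs.
have actX n : exists2 y, filt (s + t).+1 y
    & (shift_act (g ^+ n) f - f = (shift_act g f - f) *+ n + y)%R.
  elim: n => [|n [y y_filt IHn]]; first by exists 0%R; [apply:
    filt0 | rewrite shift_act1 subrr addr0].
  have w_filt : filt (s + t) (shift_act (g ^+ n) f - f)%R.
    rewrite IHn; apply: filtD; last exact: filt_le y_filt.
    by apply: filtMn; apply: gt.
  exists (shift_act g (shift_act (g ^+ n) f - f) - (shift_act (g ^+ n) f - f) +
    y)%R.
    apply: filtD => //; apply: filt_le (gt _ _ w_filt).
    by rewrite -addn1 leq_add2l.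
  rewrite expgS (actM_sub shift_actM shift_act_additive) mulrS.
  set w := (shift_act (g ^+ n) f - f)%R in IHn *.
  rewrite -[RHS]addrA [(_ - w + y)%R]addrC [X in _ = (_ + X)%R]addrA -IHn.
  by rewrite [LHS]addrC [(w + _)%R]addrC subrK.
have [y y_filt ->] := actX p; rewrite addnS; apply: filtD => //.
by apply: filt_p; apply: gt.
Qed.

(** If n is at least p^(t+1), both n - 1 and the ceiling of n / p are at least p^t, so the
    commutator and the p-th power in the recursion each add one to the depth. *)
Lemma p_central_series_depth t n : (p ^ t <= n)%N ->
  (p_central_series A p n `<=` depth t.+1)%classic.
Proof.
elim: t n => [|t IHt] n ptn g; first by move=> _; apply: depth1.
have pt_gt0 : (0 < p ^ t)%N by rewrite expn_gt0 ltnW.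
have n_gt1 : (1 < n)%N by move: ptn; rewrite expnS; nia.
have [_ depthM _] := depth_subgroup t.+2.
rewrite p_central_seriesE // => -[a Ga [b Gb <-]]; apply: depthM.
  apply: generated_min Ga; first exact: depth_subgroup.
  move=> _ [x Gx [y _ <-]]; apply/depthR/(IHt n.-1) => //.
  by move: ptn; rewrite expnS; nia.
apply: generated_min Gb; first exact: depth_subgroup.
move=> _ [x Gx <-]; apply: depthX => //; apply: IHt Gx.
rewrite /ceil_div leq_divRL; last exact: ltnW.
by rewrite -expnSr; apply: (leq_trans ptn); apply: leq_addr.
Qed.

Lemma depth_expn t g : depth t.+1 (g ^+ (p ^ t)).
Proof.
elim: t => [|t IHt]; first exact: depth1.
by rewrite expnSr expgnA; apply: depthX.
Qed.

Lemma depth_trivial r t g : (forall j, rk j <= r)%N -> (k + r <= t)%N ->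
  depth t g ->
  shift_act g = id.
Proof.
move=> rk_r kt gt; apply/funext=> f; apply/eqP; rewrite -subr_eq0; apply/eqP.
apply: (filt_end rk_r kt); rewrite -[t]add0n; exact/gt/filt_start.
Qed.

End PartialShifts.

(** * Quotients of presented groups *)

Section QuotientGroup.
Variables (X : choiceType) (R : seq (X * bool) -> seq (X * bool) -> Prop).
Local Notation A := (presented_group R).
Local Notation cls := (@word_class X R).
Variable N : set A.
Hypothesis N_subgroup : is_subgroup N.
Hypothesis N_conj : forall x y, N x -> N (x ^ y).

(** The quotient by [N] keeps the generators and imposes all relations valid modulo [N], so it is
    again a presented group. *)
Definition quot_rel u v := N ((cls u : A)^-1 * cls v).

Lemma clsM u v : cls (u ++ v) = (cls u : A) * cls v.
Proof. exact: word_class_cat. Qed.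

(** Normality of [N] makes the relation a congruence already, so closing it adds nothing. *)
Lemma quot_relP u v : word_eq quot_rel u v <-> quot_rel u v.
Proof.
have [N1 NM NV] := N_subgroup; split; last exact: word_eq_rel.
elim=> {u v} [u v //|a|u u' v v' _ uu' _ vv'|u|u v _|v u w _ vu _ uw];
  rewrite /quot_rel.
- have -> : cls [:: a; inv_letter a] = cls [::].
    exact/word_classP/word_eq_cancel.
  by rewrite mulVg.
- have -> : (cls (u ++ v))^-1 * cls (u' ++ v') =
      ((cls u)^-1 * cls u') ^ cls v * ((cls v)^-1 * cls v').
    by rewrite !clsM /conjg !gnorm.
  by apply: NM vv'; apply: N_conj.
- by rewrite mulVg.
- by move/NV; rewrite invgM invgK.
- by have := NM _ _ vu uw; rewrite mulgA mulgK.
Qed.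

Definition quot : groupType := presented_group quot_rel.

Definition quot_proj (g : A) : quot := word_class quot_rel (repr g).

Lemma quot_proj_cls w : quot_proj (cls w) = word_class quot_rel w.
Proof.
apply/word_classP/quot_relP; rewrite /quot_rel.
have -> : cls (repr (cls w)) = cls w by apply/word_classP/repr_word_class.
by rewrite mulVg; case: N_subgroup.
Qed.

Lemma quot_projM : {morph quot_proj : x y / x * y}.
Proof.
move=> x y; rewrite -[x](word_classK x) -[y](word_classK y) -clsM !quot_proj_cls.
exact: word_class_cat.
Qed.

HB.instance Definition _ := isMultiplicative.Build A quot quot_proj quot_projM.

Lemma quot_projP (x : quot) : exists g, quot_proj g = x.
Proof. by exists (cls (repr x)); rewrite quot_proj_cls; apply: word_classK. Qed.

Lemma quot_proj1 g : quot_proj g = 1 <-> N g.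
Proof.
rewrite -[g in quot_proj g](word_classK g) quot_proj_cls.
have [N1 NM NV] := N_subgroup.
split=> [/word_classP/quot_relP|Ng].
  rewrite /quot_rel -[cls [::]]/(1 : A) mulg1 => /NV.
  by rewrite invgK [X in N X](word_classK g).
apply/word_classP/quot_relP; rewrite /quot_rel -[cls [::]]/(1 : A) mulg1.
by rewrite [X in N X^-1](word_classK g); apply: NV.
Qed.

Lemma quot_proj_one : quot_proj 1 = 1.
Proof. by apply/quot_proj1; case: N_subgroup. Qed.

HB.instance Definition _ :=
  Multiplicative_isUMagmaMorphism.Build A quot quot_proj quot_proj_one.

Lemma quot_proj_inj g h : quot_proj g = quot_proj h -> N (g^-1 * h).
Proof.
move=> gh; apply/quot_proj1; rewrite quot_projM -gh -quot_projM mulVg.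
by apply/quot_proj1; case: N_subgroup.
Qed.

Lemma torsion_free_quot :
  (forall g n, (0 < n)%N -> N (g ^+ n) -> N g) -> torsion_free quot.
Proof.
move=> N_isolated x n n_gt0; have [g <-] := quot_projP x.
rewrite -(gmulfXn quot_proj) => /quot_proj1 /(N_isolated _ _ n_gt0) Ng.
exact/quot_proj1.
Qed.

Lemma residually_quot (P : groupType -> Prop) g : P quot -> ~ N g ->
  exists (Q : groupType) (f : {multiplicative A -> Q}),
    [/\ P Q, set_surj setT setT f & f g <> 1].
Proof.
move=> PQ Ng; exists quot, quot_proj; split=> //; last by move/quot_proj1.
by move=> x _; have [h <-] := quot_projP x; exists h.
Qed.

Lemma lcs_quot n x : lcs quot n x -> exists2 g, lcs A n g & quot_proj g = x.
Proof.
elim: n x => [|n IHn] x; first by have [g <-] := quot_projP x; exists g.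
case: n IHn => [_|n IHn]; first by have [g <-] := quot_projP x; exists g.
apply: (@generated_min _ _ [set x | exists2 g,
  lcs A n.+2 g & quot_proj g = x]%classic).
  split=> [|y z [g Gg <-] [h Gh <-]|y [g Gg <-]].
  - by exists 1; [apply: lcs1 | apply: quot_proj_one].
  - by exists (g * h); [apply: lcsM | apply: quot_projM].
  - by exists g^-1; [apply: lcsV | apply: (gmulfV quot_proj)].
move=> _ [y Gy [z _ <-]]; have [g Gg <-] := IHn y Gy; have [h <-] := quot_projP z.
by exists [~ g, h]; [apply: commg_lcs | apply: (gmulfR quot_proj)].
Qed.

Lemma nilpotent_quot c : N = lcs A c.+1 -> nilpotent_group quot.
Proof.
move=> NE; exists c; apply/seteqP; split=> [x /lcs_quot[g Gg <-]|_ ->] /=.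
  by apply/quot_proj1; rewrite NE.
exact: lcs1.
Qed.

End QuotientGroup.

(** * Finite p-group quotients from actions on finite sets *)

Section FinitePQuotient.
Variables (X : choiceType) (R : seq (X * bool) -> seq (X * bool) -> Prop).
Local Notation A := (presented_group R).
Variables (B : finType) (rho : A -> B -> B) (p t : nat).
Hypothesis rho1 : forall b, rho 1 b = b.
Hypothesis rhoM : forall g h b, rho (g * h) b = rho g (rho h b).
Hypothesis p_prime : prime p.
Hypothesis rho_exp : forall g b, rho (g ^+ (p ^ t)) b = b.

Definition act_kernel : set A := [set g | rho g =1 id]%classic.

Lemma act_kernel_subgroup : is_subgroup act_kernel.
Proof.
split=> [b|x y Nx Ny b|x Nx b]; first exact: rho1.
  by rewrite rhoM Ny Nx.
by rewrite -{1}[b]Nx -rhoM mulVg rho1.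
Qed.

Lemma act_kernelJ x y : act_kernel x -> act_kernel (x ^ y).
Proof. by move=> Nx b; rewrite /conjg !rhoM Nx -rhoM mulVg rho1. Qed.

Lemma rho_inj g : injective (rho g).
Proof.
by move=> b c /(congr1 (rho g^-1)); rewrite -!rhoM mulVg !rho1.
Qed.

Definition rho_perm g : {perm B} := perm (@rho_inj g).

Definition rho_image : {set {perm B}} := [set s | `[< exists g, s = rho_perm g >]].

(** Permutations compose from left to right, so [rho_perm] reverses products; its image is still a
    subgroup. *)
Lemma rho_permM g h : (rho_perm g * rho_perm h)%g = rho_perm (h * g).
Proof. by apply/perm.permP=> b; rewrite permM !permE rhoM. Qed.

Lemma rho_image_group : group_set rho_image.
Proof.
apply/group_setP; split=> [|s u].
  by rewrite !inE; exists 1; apply/perm.permP=> b; rewrite !permE rho1.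
rewrite !inE => -[g ->] [h ->]; exists (h * g).
exact: rho_permM.
Qed.

Canonical rho_group := group rho_image_group.

Lemma rho_image_pgroup : p.-group rho_group.
Proof.
rewrite -pnat_exponent; apply: (@pnat_dvd _ (p ^ t)); last by rewrite pnatX pnat_id.
apply/exponentP=> s; rewrite !inE => -[g ->].
have rhoX n : (rho_perm g ^+ n)%g = rho_perm (g ^+ n).
  elim: n => [|n IHn]; first by apply/perm.permP=> b; rewrite !permE rho1.
  by rewrite expgSr IHn rho_permM -expgS.
by rewrite rhoX; apply/perm.permP=> b; rewrite !permE rho_exp.
Qed.

Lemma finite_p_group_quot : finite_p_group (quot act_kernel) p.
Proof.
have [n card_rho] := p_natP rho_image_pgroup; exists n.
pose pre x := projT1 (cid (quot_projP act_kernel_subgroup act_kernelJ x)).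
have preK x : quot_proj act_kernel (pre x) = x by exact:
  (projT2 (cid (quot_projP act_kernel_subgroup act_kernelJ x))).
(* Numbering the image of the action transports its cardinality to the quotient. *)
pose idx x := index (rho_perm (pre x)) (enum rho_image).
have mem_rho g : rho_perm g \in enum rho_image.
  by rewrite mem_enum !inE; exists g.
have rho_eq g h : rho_perm g = rho_perm h ->
  quot_proj act_kernel g = quot_proj act_kernel h.
  move=> gh; rewrite -[h](mulVKg g) (quot_projM act_kernel_subgroup act_kernelJ).
  have /(quot_proj1 act_kernel_subgroup act_kernelJ) -> : act_kernel (g^-1 * h);
    last by rewrite mulg1.
  move=> b; rewrite rhoM; have /perm.permP/(_ b) := gh; rewrite !permE => <-.
  by rewrite -rhoM mulVg rho1.
have idx_inj : injective idx.
  move=> x y /(congr1 (nth 1%g (enum rho_image))); rewrite !nth_index // => /rho_eq.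
  by rewrite !preK.
rewrite -card_rho; have /card_esym := @inj_card_eq _ _ [set:
  quot act_kernel]%classic idx (in2W idx_inj).
suff -> : (idx @` setT = `I_#|rho_group|)%classic by [].
apply/seteqP; split=> [_ [x _ <-]|i] /=.
  by rewrite cardE index_mem.
rewrite cardE => i_lt; have := mem_nth 1%g i_lt; rewrite mem_enum !inE => -[g gi].
exists (quot_proj act_kernel g) => //.
rewrite /idx; have -> : rho_perm (pre (quot_proj act_kernel g)) = rho_perm g.
  have := preK (quot_proj act_kernel g) =>
    /(quot_proj_inj act_kernel_subgroup act_kernelJ) Ngh.
  apply/perm.permP=> b; rewrite !permE -[g in RHS](mulVKg (pre (quot_proj
    act_kernel g))).
  by rewrite rhoM Ngh.
by rewrite -gi index_uniq // enum_uniq.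
Qed.

End FinitePQuotient.

(** * Separation of elements *)

Section HeapAction.
Variables (V : finType) (E : {set {set V}}) (r p k : nat).
Hypothesis adjI : irreflexive (adj E).
Hypothesis p_gt1 : (1 < p)%N.
Hypothesis k_gt0 : (0 < k)%N.
Local Notation J := (r.-bseq V).
Local Notation del := (del (adj E)).
Local Notation reduced := (reduced (adj E)).

(** Words of length at most [r] form a finite type. Unreduced words are sent to [None] because a
    double deletion need not fail on them. *)
Definition heap_shift v (j : J) : option J :=
  if reduced j then obind insub (del v j) else None.

Lemma heap_shiftE v (j : J) : reduced j -> omap val (heap_shift v j) = del v j.
Proof.
rewrite /heap_shift => ->; case jt: (del v j) => [t|] //=.
by rewrite insubT // -ltnS -(size_del jt) ltnW // ltnS size_bseq.
Qed.

Lemma heap_shift_bind a b (j : J) : reduced j ->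
  omap val (obind (heap_shift a) (heap_shift b j)) = obind (del a) (del b j).
Proof.
move=> rj; rewrite -heap_shiftE //; case bj: (heap_shift b j) => [t|] //=.
apply: heap_shiftE; apply: (reduced_del (adjC E) adjI rj (v := b)).
by rewrite -heap_shiftE // bj.
Qed.

Lemma heap_shift_unreduced v (j : J) : ~~ reduced j -> heap_shift v j = None.
Proof. by rewrite /heap_shift => /negPf ->. Qed.

Lemma heap_shiftC a b j : adj E a b ->
  obind (heap_shift a) (heap_shift b j) = obind (heap_shift b) (heap_shift a j).
Proof.
move=> ab; have [rj|rj] := boolP (reduced j); last by rewrite !heap_shift_unreduced.
apply: (@inj_omap _ _ (val : J -> seq V)); first exact: val_inj.
by rewrite !heap_shift_bind // (delC (adjC E) adjI _ ab).
Qed.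

Lemma heap_shift_shift v j : obind (heap_shift v) (heap_shift v j) = None.
Proof.
have [rj|rj] := boolP (reduced j); last by rewrite !heap_shift_unreduced.
apply: (@inj_omap _ _ (val : J -> seq V)); first exact: val_inj.
by rewrite heap_shift_bind // (del_del v rj).
Qed.

Lemma size_heap_shift v j j' : heap_shift v j = Some j' -> size j = (size j').+1.
Proof.
move=> jj'; have [rj|rj] := boolP (reduced j);
  last by rewrite heap_shift_unreduced in jj'.
by apply: (size_del (e := adj E) (v := v)); rewrite -heap_shiftE // jj'.
Qed.

Local Notation act := (@shift_act V E J heap_shift p k).

Lemma heap_act1 f : act 1 f = f.
Proof. exact: shift_act1 heap_shiftC heap_shift_shift _. Qed.

Lemma heap_actM g h f : act (g * h) f = act g (act h f).
Proof. exact: shift_actM heap_shiftC heap_shift_shift _ _ _. Qed.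

Local Notation depth := (@depth V E J heap_shift (fun j => size j) p k).

Lemma heap_act_trivial t g : (k + r < t)%N -> depth t g -> act g = id.
Proof.
move=> kt; apply: (depth_trivial p_gt1 k_gt0) (ltnW kt) => j.
exact: size_bseq.
Qed.

Lemma heap_act_p_central_series g :
  p_central_series (raag E) p (p ^ (k + r)) g -> act g = id.
Proof.
move=> Gg; apply: heap_act_trivial (ltnSn _) _.
apply: (p_central_series_depth heap_shiftC heap_shift_shift size_heap_shift) Gg =>
  //.
Qed.

Lemma heap_act_lcs g : lcs (raag E) (k + r).+1 g -> act g = id.
Proof.
suffices lcs_depth n h : lcs (raag E) n.+1 h -> depth n.+1 h.
  by move/lcs_depth; apply: heap_act_trivial.
elim: n h => [|n IHn] h.
  by move=> _; apply: (depth1 heap_shiftC heap_shift_shift size_heap_shift).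
apply: generated_min; first exact: (depth_subgroup _ _ heap_shiftC heap_shift_shift
  size_heap_shift).
move=> _ [x Gx [y _ <-]].
by apply: (depthR heap_shiftC heap_shift_shift size_heap_shift); apply: IHn.
Qed.

Lemma heap_act_expn g f : act (g ^+ (p ^ (k + r))) f = f.
Proof.
rewrite (heap_act_trivial (ltnSn _)) //.
exact: (depth_expn heap_shiftC heap_shift_shift size_heap_shift).
Qed.

Definition exp_prod (s : seq (V * int)) : int := foldr (fun x z => x.2 * z)%R 1%R s.

Definition nil_delta : {ffun J -> 'Z_(p ^ k)} := [ffun j : J => (nilp j)%:R%R].

(** Each syllable acts as 1 + e X and lengthens the support by at most one. At a word with one
    letter per syllable, the identity part therefore contributes nothing and the exponents
    multiply. *)
Lemma heap_act_nil_delta s :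
  let f := act (syllable_prod E s) nil_delta in
  (forall j : J, (size s < size j)%N -> f j = 0%R) /\
  (forall j : J, val j = unzip1 s -> reduced (unzip1 s) ->
    f j = (exp_prod s)%:~R%R).
Proof.
elim: s => [|x s [IH0 IH1]] /=.
  rewrite heap_act1.
  split=> [j j0|j j0 _]; rewrite ffunE.
    by rewrite /nilp eqn0Ngt j0.
  by rewrite /nilp j0.
rewrite heap_actM (shift_act_zexpg heap_shiftC heap_shift_shift).
set f := act _ _ in IH0 IH1 *.
have MzE (h : {ffun J -> 'Z_(p ^ k)}) c j : (h *~ c)%R j = (h j *~ c)%R.
  by apply: (@zmod_morphismMz _ _ (fun h : {ffun J -> 'Z_(p ^ k)} => h j)) => u w;
    rewrite !ffunE.
split=> [j sj|j jE /andP[/eqP xs0 rs]]; rewrite ffunE MzE ffunE.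
  rewrite IH0 1?ltnW // add0r; case jj': (heap_shift x.1 j) => [j'|] /=;
    last by rewrite mul0rz.
  by rewrite IH0 ?mul0rz // -ltnS -(size_heap_shift jj').
rewrite IH0 ?add0r; last by rewrite jE /= size_map.
have rj : reduced j by rewrite jE /= xs0 eqxx.
have := heap_shiftE x.1 rj; rewrite jE /= eqxx.
case: (heap_shift x.1 j) => [j'|] //= [j's]; rewrite IH1 //.
by rewrite -mulrzA mulrC.
Qed.

End HeapAction.

Lemma heap_act_faithful (V : finType) (E : {set {set V}}) (p : nat) (g : raag E) :
  irreflexive (adj E) -> (1 < p)%N -> g <> 1 ->
  exists r k, (0 < k)%N /\
    exists f, @shift_act V E (r.-bseq V) (@heap_shift V E r) p k g f <> f.
Proof.
move=> adjI p_gt1; have [s [rs s0 <-]] := reduced_form adjI g => s1.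
have z0 : exp_prod s != 0%R.
  elim: s s0 {rs s1} => //= x s IHs /andP[x0 /IHs].
  exact: mulf_neq0.
(* With [k] the absolute value of the product of the exponents, 0 < k < p^k, so this product is
   non-zero modulo p^k. *)
pose k := `|exp_prod s|%N; have k_gt0 : (0 < k)%N by rewrite absz_gt0.
have k_lt : (k < p ^ k)%N by apply: ltn_expl.
exists (size s), k; split=> //; exists (@nil_delta V (size s) p k).
have js : (size (unzip1 s) <= size s)%N by rewrite size_map.
have [_ /(_ (Bseq js) erefl rs) actE] :=
  @heap_act_nil_delta V E (size s) p k adjI s.
have s_gt0 : (size s == 0)%N = false by case: s s1 {rs s0 z0 k k_gt0 k_lt js actE}.
move=> /ffunP/(_ (Bseq js)); rewrite actE ffunE /nilp /= size_map s_gt0 => z_eq0.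
have pk_gt1 : (1 < p ^ k)%N by apply: leq_ltn_trans k_lt.
suffices : (k%:R : 'Z_(p ^ k))%R = 0%R.
  by move/(congr1 val); rewrite /= val_Zp_nat // modn_small // => k0;
    rewrite k0 in k_gt0.
have absR (R : pzRingType) (z : int) : (z%:~R = 0 :> R)%R -> (`|z|%N%:R = 0 :> R)%R.
  by case: z => n //; rewrite NegzE mulrNz => /eqP; rewrite oppr_eq0 => /eqP.
exact: absR.
Qed.

Lemma p_central_series_one (G : groupType) p n : p_central_series G p n 1.
Proof.
rewrite /p_central_series; elim: n {2}n => [|n IHn] m //=; case: ifP => // _.
have generated1 (X : set G) : generated X 1 by case: (generated_subgroup X).
by exists 1; [apply: generated1 | exists 1; [apply: generated1 | rewrite mulg1]].
Qed.

Theorem theorem1 (V : finType) (E : {set {set V}})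
    (hE : forall e : {set V}, e \in E -> #|e| = 2) :
  (forall n : nat, (1 <= n)%N -> lcs (raag E) n = rational_lcs (raag E) n) /\
  (\bigcap_(n in [set n : nat | (1 <= n)%N]) rational_lcs (raag E) n
     = [set 1%g])%classic /\
  (forall p : nat, prime p ->
     (\bigcap_(n in [set n : nat | (1 <= n)%N]) p_central_series (raag E) p n
        = [set 1%g])%classic) /\
  finitely_generated (raag E) /\
  residually (raag E) (fun Q => torsion_free Q /\ nilpotent_group Q) /\
  (forall p : nat, prime p -> residually (raag E) (fun Q => finite_p_group Q p)).
Proof.
(* A loop would be an edge with a single element. *)
have adjI : irreflexive (adj E).
  move=> v; apply/negP=> /hE; rewrite finset.setUid cards1 //.
(* The prime 2 is an arbitrary choice: the representation modulo any prime power kills a term of the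
   lower central series. *)
have separated g : g <> 1 -> exists c, ~ lcs (raag E) c.+1 g.
  move=> /(heap_act_faithful adjI (leqnn 2)) [r [k [k_gt0 [f actf]]]].
  by exists (k + r)%N => /(heap_act_lcs adjI (leqnn 2) k_gt0) actg;
    rewrite actg in actf.
split; first exact: rational_lcsE.
split.
  apply/seteqP; split=> [g Gg|_ -> n n_gt0] /=; last by rewrite -rational_lcsE //;
    apply: lcs1.
  apply: contrapT => /separated[c]; apply.
  by rewrite rational_lcsE //; apply: Gg.
split=> [p /prime_gt1 p_gt1|].
  apply/seteqP; split=> [g Gg|_ -> n _] /=; last exact: p_central_series_one.
  apply: contrapT => /(heap_act_faithful adjI p_gt1)[r [k [k_gt0 [f]]]]; apply.
  rewrite (heap_act_p_central_series adjI p_gt1 k_gt0) //.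
  by apply: Gg; rewrite /= expn_gt0 ltnW.
split.
  exists [set gen E v | v in [set: V]]%classic;
    first exact/finite_image/finite_finset.
  apply/seteqP; split=> // g _; set S := (X in generated X).
  have [S1 SM SV] := generated_subgroup S.
  have Sgen v : generated S (gen E v) by apply: sub_generated; exists v.
  by elim/gen_ind: g => [|v g Sg|v g Sg] //; apply: SM => //; apply: SV.
split=> [g /separated[c Ncg]|p p_prime g].
  have lcs_sub := lcs_subgroup (raag E) c.+1.
  have lcs_conj := fun y z => @lcsJ (raag E) c.+1 y z.
  (* The quotient by gamma_(c+1) is torsion-free because this term coincides with its rational
     version. *)
  apply: (residually_quot lcs_sub lcs_conj) Ncg; split; last exact: nilpotent_quot.
  apply: torsion_free_quot => // h n n_gt0 Ghn.
  by rewrite rational_lcsE //; exists (Posz n) => //; case: n n_gt0 {Ghn}.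
have p_gt1 := prime_gt1 p_prime.
move=> /(heap_act_faithful adjI p_gt1)[r [k [k_gt0 [f actf]]]].
set act := @shift_act V E _ _ p k in actf.
have act1 : forall b, act 1 b = b by apply: heap_act1.
have actM : forall x y b, act (x * y) b = act x (act y b) by apply: heap_actM.
(* The quotient by the kernel embeds in the permutations of a finite module and has exponent
   dividing p^(k+r). *)
apply: (residually_quot (act_kernel_subgroup act1 actM) (act_kernelJ act1 actM)).
  apply: (finite_p_group_quot (t := (k + r)%N)) => // h b.
  exact: heap_act_expn.
by move=> /(_ f).
Qed.
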